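(* Let $\lambda\geq0$, $\nu>0$ and $\alpha\in\left(-\frac{1}{2}-\frac{\nu}{2},-\frac{1}{2}\right]$. Let $$\phi(x):=\frac{(x+\nu)(x+\nu+2\alpha)}{(2x+2\nu+2\alpha+2\lambda+1)(2x+2\nu+2\alpha+2\lambda-1)}\quad(x\in[1,\infty)).$$ Then $c_0=0$ and $c_n=\frac{\phi(n)}{1-c_{n-1}}$ $(n\in\mathbb{N})$ define a sequence $(c_n)_{n\in\mathbb{N}}\subseteq(0,1)$. Define $(P_n(x))_{n\in\mathbb{N}_0}=:(Q_n^{(\alpha,\lambda,\nu)}(x))_{n\in\mathbb{N}_0}$ via $a_n:=1-c_n$, $P_0(x)=1$, $P_1(x)=x$ and $xP_n(x)=a_nP_{n+1}(x)+c_nP_{n-1}(x)$ $(n\in\mathbb{N})$. Then: (1) $(c_n)_{n\in\mathbb{N}}$ is strictly increasing; (2) $(P_n(x))_{n\in\mathbb{N}_0}$ satisfies the nonnegative linearization property (P), i.e., for all $m,n\in\mathbb{N}_0$ all coefficients $g(m,n;k)$ in $P_m(x)P_n(x)=\sum_{k=0}^{m+n}g(m,n;k)P_k(x)$ are nonnegative; (3) $(P_n(x))_{n\in\mathbb{N}_0}$ satisfies Tur\'{a}n's inequality, i.e., for all $n\in\mathbb{N}$ one has $(P_n(x))^2-P_{n+1}(x)P_{n-1}(x)\geq0$ for $x\in[-1,1]$ and $(P_n(x))^2-P_{n+1}(x)P_{n-1}(x)>0$ for $x\in(-1,1)$; (4) $c_n<\frac{1}{2}\left(1-\sqrt{\max\{0,1-4\phi(n+1)\}}\right)$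 for all $n\in\mathbb{N}$. Moreover, $\ell^1(h)$ is not point amenable (and hence not weakly amenable, not right character amenable and not amenable).
   Context: $\mathbb{N}=\{1,2,3,\ldots\}$, $\mathbb{N}_0=\mathbb{N}\cup\{0\}$. \textbf{The algebra $\ell^1(h)$.} The polynomials $P_n$ are orthogonal with respect to a unique symmetric probability Borel measure $\mu$ on $\mathbb{R}$, and one has $P_m(x)P_n(x)=\sum_{k=|m-n|}^{m+n}g(m,n;k)P_k(x)$. Let $h(n):=1/g(n,n;0)=1/\int_{\mathbb{R}}P_n^2\,\mathrm{d}\mu$; equivalently $h(0)=1$, $h(n+1)=\frac{a_n}{c_{n+1}}h(n)$ (with $a_0=1$). Let $\ell^1(h):=\{f:\mathbb{N}_0\to\mathbb{C}:\|f\|_1:=\sum_{k=0}^\infty|f(k)|h(k)<\infty\}$. For $f:\mathbb{N}_0\to\mathbb{C}$ let $T_nf(m):=\sum_{k=|m-n|}^{m+n}g(m,n;k)f(k)$, and for $f,g\in\ell^1(h)$ let $f\ast g(n):=\sum_{k=0}^\infty T_nf(k)g(k)h(k)$. Given property (P), with this convolution and $\|\cdot\|_1$, $\ell^1(h)$ is a commutative unital Banach algebra. Let $\widehat{\mathbb{N}_0}:=\{x\in\mathbb{R}:\sup_{n\in\mathbb{N}_0}|P_n(x)|<\infty\}$, and for $f\in\ell^1(h)$ and $x\in\widehat{\mathbb{N}_0}$ let $\widehat{f}(x):=\sum_{k=0}^\infty f(k)P_k(x)h(k)$. \textbf{Amenability notions.} $\ell^1(h)$ is called point amenable if there is no $x\in\widehat{\mathbb{N}_0}$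 admitting a nonzero bounded linear functional $D:\ell^1(h)\to\mathbb{C}$ with $D(f\ast g)=\widehat{f}(x)D(g)+\widehat{g}(x)D(f)$ for all $f,g\in\ell^1(h)$. For a Banach algebra $A$ with structure space $\Delta(A)$ (the nonzero multiplicative linear functionals): a derivation into a Banach $A$-bimodule $X$ is a linear map $D:A\to X$ with $D(ab)=a\cdot D(b)+D(a)\cdot b$; it is inner if $D(a)=a\cdot x-x\cdot a$ $(a\in A)$ for some $x\in X$. $A$ is amenable if for every Banach $A$-bimodule $X$ every bounded derivation from $A$ into the dual module $X^\ast$ is inner; weakly amenable if every bounded derivation from $A$ into $A^\ast$ is inner; $\varphi$-amenable, for $\varphi\in\Delta(A)$, if for every Banach $A$-bimodule $X$ such that $a\cdot x=\varphi(a)x$ $(a\in A,x\in X)$ every bounded derivation from $A$ into $X^\ast$ is inner; right character amenable if $A$ is $\varphi$-amenable for every $\varphi\in\Delta(A)$ and $A$ has a bounded right approximate identity. *)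

(* Defs.v *)
From HB Require Import structures.
From mathcomp Require Import all_boot all_order all_algebra complex.
From mathcomp Require Import all_classical all_reals all_analysis.

Set Implicit Arguments.
Unset Strict Implicit.
Unset Printing Implicit Defensive.

Import Order.TTheory GRing.Theory Num.Theory numFieldNormedType.Exports.

Local Open Scope classical_set_scope.
Local Open Scope ring_scope.
Local Open Scope complex_scope.

Section OrthogonalPolynomials.
Variable R : realType.
Implicit Types (c : nat -> R) (x : R) (n m k : nat).

Definition phi (alpha lambda nu x : R) : R :=
  ((x + nu) * (x + nu + 2 * alpha)) /
  ((2 * x + 2 * nu + 2 * alpha + 2 * lambda + 1) *
   (2 * x + 2 * nu + 2 * alpha + 2 * lambda - 1)).

Fixpoint cseq (alpha lambda nu : R) n : R :=
  if n is m.+1 then phi alpha lambda nu n%:R / (1 - cseq alpha lambda nu m)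
  else 0.

Fixpoint orthopoly c n : {poly R} :=
  match n with
  | 0 => 1
  | 1 => 'X
  | (m.+1 as n').+1 =>
      (1 - c n')^-1 *: ('X * orthopoly c n' - c n' *: orthopoly c m)
  end.

Lemma orthopoly_rec c n : (0 < n)%N -> c n != 1 ->
  'X * orthopoly c n =
  (1 - c n) *: orthopoly c n.+1 + c n *: orthopoly c n.-1.
Proof.
case: n => // n _ cn1; have a0 : 1 - c n.+1 != 0 by rewrite subr_eq0 eq_sym.
by rewrite [orthopoly c n.+2]/= scalerA divff// scale1r subrK.
Qed.

Lemma size_orthopoly c n : (forall k, c k != 1) -> size (orthopoly c n) = n.+1.
Proof.
move=> c1; elim/ltn_ind: n => -[|[|n]] IH.
- by rewrite size_poly1.
- by rewrite size_polyX.
have a0 : (1 - c n.+1)^-1 != 0 by rewrite invr_eq0 subr_eq0 eq_sym.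
have sn1 := IH n.+1 (ltnSn _); have sn := IH n (leqnSn _).
have sX : size ('X * orthopoly c n.+1) = n.+3.
  by rewrite mulrC size_mulX ?sn1// -size_poly_eq0 sn1.
rewrite [orthopoly c n.+2]/= size_scale // size_polyDl ?sX //.
by rewrite size_polyN (leq_ltn_trans (size_scale_leq _ _))// sn.
Qed.

Lemma orthopoly_basis c (p : {poly R}) N : (forall k, c k != 1) ->
  (size p <= N)%N ->
  exists2 g : nat -> R, p = \sum_(k < N) g k *: orthopoly c k &
    forall k, (N <= k)%N -> g k = 0.
Proof.
move=> c1; elim: N p => [|N IH] p.
  rewrite leqn0 size_poly_eq0 => /eqP ->; exists (fun=> 0) => //.
  by rewrite big_ord0.
move=> sp; set P := orthopoly c N.
have sP : size P = N.+1 by exact: size_orthopoly.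
have P0 : P`_N != 0.
  by rewrite -[N]/(N.+1.-1) -sP -lead_coefE lead_coef_eq0 -size_poly_eq0 sP.
pose b := p`_N / P`_N.
have sq : (size (p - b *: P)%R <= N)%N.
  apply/leq_sizeP => j; rewrite leq_eqVlt => /predU1P[<-|Nj].
    by rewrite coefB coefZ divfK// subrr.
  rewrite coefB coefZ (leq_sizeP _ _ sp j Nj).
  by rewrite (_ : P`_j = 0) ?mulr0 ?subr0// nth_default// sP.
have [g gp g0] := IH _ sq.
exists (fun k => if k == N then b else g k) => [|k Nk]; last first.
  by rewrite gtn_eqF// g0// ltnW.
rewrite big_ord_recr/= eqxx.
under eq_bigr => i _ do rewrite ltn_eqF//.
by rewrite -gp subrK.
Qed.

(* [lincoef c m n k] is the linearization coefficient g(m,n;k); it is uniquely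
   determined as soon as [c] avoids 1, see [lincoefP] and [lincoef_uniq]. *)
Definition is_lincoef c m n (g : nat -> R) : Prop :=
  orthopoly c m * orthopoly c n = \sum_(k < (m + n).+1) g k *: orthopoly c k /\
  forall k, (m + n < k)%N -> g k = 0.

Definition lincoef c m n : nat -> R := xget (fun=> 0) [set g | is_lincoef c m n g].

Lemma lincoefP c m n : (forall k, c k != 1) ->
  is_lincoef c m n (lincoef c m n).
Proof.
move=> c1; apply: (@xgetPex _ _ [set g | is_lincoef c m n g]).
have sp : (size (orthopoly c m * orthopoly c n)%R <= (m + n).+1)%N.
  by rewrite (leq_trans (size_polyMleq _ _))// !size_orthopoly// addSn/= addnS.
by have [g gE g0] := orthopoly_basis c1 sp; exists g.
Qed.

Lemma orthopoly_free c N (g : nat -> R) : (forall k, c k != 1) ->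
  \sum_(k < N) g k *: orthopoly c k = 0 -> forall k, (k < N)%N -> g k = 0.
Proof.
move=> c1; elim: N => // N IH; rewrite big_ord_recr/= => gE.
set P := orthopoly c N in gE.
have sP : size P = N.+1 by exact: size_orthopoly.
have P0 : P`_N != 0.
  by rewrite -[N]/(N.+1.-1) -sP -lead_coefE lead_coef_eq0 -size_poly_eq0 sP.
have gN : g N = 0.
  move/(congr1 (fun p : {poly R} => p`_N)): gE.
  rewrite coefD coef_sum big1 ?add0r ?coefZ ?coef0 => [/eqP|i _].
    by rewrite mulf_eq0 (negbTE P0) orbF => /eqP.
  by rewrite coefZ nth_default ?mulr0// size_orthopoly.
move=> k; rewrite ltnS leq_eqVlt => /predU1P[->//|]; apply: IH.
by rewrite -[RHS]gE gN scale0r addr0.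
Qed.

Lemma lincoef_uniq c m n (g : nat -> R) : (forall k, c k != 1) ->
  is_lincoef c m n g -> lincoef c m n = g.
Proof.
move=> c1 [gE g0]; have [lE l0] := lincoefP m n c1; apply/funext => k.
have [kmn|kmn] := ltnP (m + n) k; first by rewrite l0// g0.
apply/eqP; rewrite -subr_eq0; apply/eqP.
apply: (@orthopoly_free c (m + n).+1 (fun k => lincoef c m n k - g k)) => //.
under eq_bigr => i _ do rewrite scalerBl.
by rewrite sumrB -lE -gE subrr.
Qed.

Definition nonneg_linearization c : Prop :=
  forall m n k, (k <= m + n)%N -> 0 <= lincoef c m n k.

Definition turan_inequality c : Prop :=
  forall n, (0 < n)%N ->
    let T x := (orthopoly c n).[x] ^+ 2 -
               (orthopoly c n.+1).[x] * (orthopoly c n.-1).[x] in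
    (forall x, -1 <= x <= 1 -> 0 <= T x) /\ (forall x, -1 < x < 1 -> 0 < T x).

Definition haar c n : R := (lincoef c n n 0%N)^-1.

Definition dual_space c : set R :=
  [set x | has_ubound (range (fun n => `|(orthopoly c n).[x]|))].

End OrthogonalPolynomials.

(* Algebras and bimodules are presented as a subset of an ambient vector space,
   together with a norm and operations which are only meaningful on that subset:
   the product of l^1(h) is defined by series on all sequences, and l^1(h) is
   stable under it only because of nonnegative linearization.  All the notions
   below ignore what happens outside the subset.  Norms take values in the
   scalar field, as in [normedModType]. *)
Section Amenability.
Variable K : numFieldType.

Definition linear_on (V : lmodType K) (S : set V) (f : V -> K) : Prop :=
  forall (k : K) (u v : V), S u -> S v -> f (k *: u + v) = k * f u + f v.

Definition bounded_functional (V : lmodType K) (S : set V) (nrm : V -> K)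
    (f : V -> K) : Prop :=
  linear_on S f /\ exists M : K, forall u, S u -> `|f u| <= M * nrm u.

Record normed_algebra := NormedAlgebra {
  alg_space :> lmodType K;
  alg_set : set alg_space;
  alg_norm : alg_space -> K;
  alg_mul : alg_space -> alg_space -> alg_space }.

Record normed_bimodule (A : normed_algebra) := NormedBimodule {
  bim_space :> lmodType K;
  bim_set : set bim_space;
  bim_norm : bim_space -> K;
  lact : A -> bim_space -> bim_space;
  ract : bim_space -> A -> bim_space }.

Variable A : normed_algebra.

Definition algebra_bimodule : normed_bimodule A :=
  @NormedBimodule A A (@alg_set A) (@alg_norm A) (@alg_mul A) (@alg_mul A).

Definition is_banach_bimodule (X : completeNormedModType K)
    (l : A -> X -> X) (r : X -> A -> X) : Prop :=
  [/\ forall a, alg_set a -> forall (k : K) x y,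
        l a (k *: x + y) = k *: l a x + l a y /\
        r (k *: x + y) a = k *: r x a + r y a,
      forall a b, alg_set a -> alg_set b -> forall (k : K) x,
        l (k *: a + b) x = k *: l a x + l b x /\
        r x (k *: a + b) = k *: r x a + r x b,
      forall a b, alg_set a -> alg_set b -> forall x,
        [/\ l (alg_mul a b) x = l a (l b x),
            r x (alg_mul a b) = r (r x a) b &
            l a (r x b) = r (l a x) b] &
      exists M : K, forall a, alg_set a -> forall x,
        `|l a x| <= M * alg_norm a * `|x| /\ `|r x a| <= M * alg_norm a * `|x| ].

Definition banach_bimodule (X : completeNormedModType K)
    (l : A -> X -> X) (r : X -> A -> X) : normed_bimodule A :=
  @NormedBimodule A X setT (fun x => `|x|) l r.

(* Bounded derivations D from A into the dual module of X, with the dual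
   actions (a . f)(x) = f(x . a) and (f . a)(x) = f(a . x). *)
Definition dual_derivation (X : normed_bimodule A) (D : A -> X -> K) : Prop :=
  [/\ forall a, alg_set a ->
        bounded_functional (@bim_set _ X) (@bim_norm _ X) (D a),
      forall x, bim_set x -> linear_on (@alg_set A) (D ^~ x),
      exists M : K, forall a x, alg_set a -> bim_set x ->
        `|D a x| <= M * alg_norm a * bim_norm x &
      forall a b x, alg_set a -> alg_set b -> bim_set x ->
        D (alg_mul a b) x = D b (ract x a) + D a (lact b x) ].

Definition dual_inner (X : normed_bimodule A) (D : A -> X -> K) : Prop :=
  exists2 f : X -> K, bounded_functional (@bim_set _ X) (@bim_norm _ X) f &
    forall a x, alg_set a -> bim_set x -> D a x = f (ract x a) - f (lact a x).

Definition dual_derivations_inner (X : normed_bimodule A) : Prop :=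
  forall D : A -> X -> K, dual_derivation D -> dual_inner D.

Definition amenable : Prop :=
  forall (X : completeNormedModType K) (l : A -> X -> X) (r : X -> A -> X),
    is_banach_bimodule l r -> dual_derivations_inner (banach_bimodule l r).

Definition weakly_amenable : Prop := dual_derivations_inner algebra_bimodule.

Definition structure_space (f : A -> K) : Prop :=
  [/\ linear_on (@alg_set A) f,
      forall a b, alg_set a -> alg_set b -> f (alg_mul a b) = f a * f b &
      exists2 a, alg_set a & f a != 0 ].

Definition char_amenable (f : A -> K) : Prop :=
  forall (X : completeNormedModType K) (l : A -> X -> X) (r : X -> A -> X),
    is_banach_bimodule l r ->
    (forall a x, alg_set a -> l a x = f a *: x) ->
    dual_derivations_inner (banach_bimodule l r).

(* Nets are rendered as families indexed by a type with a proper filter. *)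
Definition has_bounded_right_approximate_identity : Prop :=
  exists (I : Type) (F : set_system I) (e : I -> A),
    [/\ ProperFilter F,
        forall i, alg_set (e i),
        exists M : K, forall i, alg_norm (e i) <= M &
        forall a, alg_set a ->
          alg_norm (alg_mul a (e i) - a) @[i --> F] --> (0 : K) ].

Definition right_character_amenable : Prop :=
  (forall f : A -> K, structure_space f -> char_amenable f) /\
  has_bounded_right_approximate_identity.

End Amenability.

Section L1Algebra.
Variables (R : realType) (c : nat -> R).
Local Notation C := R[i]^o.
Implicit Types (f g : nat -> C) (m n k : nat).

Definition l1norme f : \bar R :=
  (\sum_(0 <= k <oo) (complex.Re `|f k| * haar c k)%:E)%E.

Definition l1 : set (nat -> C) := [set f | (l1norme f < +oo)%E].

Definition l1norm f : C := (fine (l1norme f))%:C.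

Definition translation n f m : C :=
  \sum_(`|m - n|%N <= k < (m + n).+1) (lincoef c m n k)%:C * f k.

Definition convolution f g : nat -> C := fun n =>
  limn (series (fun k => translation n f k * g k * (haar c k)%:C : C)).

Definition fourier f (x : R) : C :=
  limn (series (fun k => f k * ((orthopoly c k).[x])%:C * (haar c k)%:C : C)).

Definition l1_algebra : normed_algebra R[i] :=
  @NormedAlgebra R[i] (nat -> C) l1 l1norm convolution.

Definition point_amenable : Prop :=
  ~ exists2 x : R, dual_space c x & exists D : (nat -> C) -> R[i],
    [/\ bounded_functional l1 l1norm D,
        exists2 f, l1 f & D f != 0 &
        forall f g, l1 f -> l1 g ->
          D (convolution f g) = fourier f x * D g + fourier g x * D f ].

End L1Algebra.

(* Main.v *)
From HB Require Import structures.
Require Import Defs.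
From mathcomp Require Import all_boot all_order all_algebra complex.
From mathcomp Require Import all_classical all_reals all_analysis.
From mathcomp Require Import ring lra zify.

Set Implicit Arguments.
Unset Strict Implicit.
Unset Printing Implicit Defensive.

Import Order.TTheory GRing.Theory Num.Theory numFieldNormedType.Exports.

Local Open Scope classical_set_scope.
Local Open Scope ring_scope.

(** Write [y = 2 x + 2 nu + 2 alpha]; then
    [4 phi(x) = (y^2 - 4 alpha^2) / ((y + 2 lambda)^2 - 1)], and [alpha <= -1/2]
    makes [phi] nondecreasing with values in [(0, 1/4]].  As
    [c_{n+1} (1 - c_n) = phi(n+1)], induction gives [c_n < c_{n+1}] and
    [c_n < 1/2]; the root bound only restates
    [c_n (1 - c_n) < c_{n+1} (1 - c_n) = phi(n+1)], see [cseq_increasing] and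
    [cseq_lt_root].  Comparison with the constant case [phi = 1/4], where the
    [P_n] are the Chebyshev polynomials [U_n / (n+1)], gives
    [c_n <= n / (2 (n+1))].

    Nonnegative linearization is Askey's argument.  The monic multiples [M_n] of
    [P_n] satisfy [x M_n = M_{n+1} + phi(n) M_{n-1}], and for [m <= n] both
    [M_m M_n] and the cross difference [M_{m+1} M_n - M_m M_{n+1}] have
    nonnegative coefficients, by induction on [m], because [phi] is
    nondecreasing ([cone_cross]).

    For Turan's inequality let [D_n = P_n^2 - P_{n+1} P_{n-1}].  The recurrence
    turns [(1 - c_n) D_n] into a quadratic form in [P_n] and [P_{n-1}], which is
    nonnegative on [[-1, 1]] when [|P_{n-1}| <= |P_n|], and also yields
    [(1 - c_n) D_n = c_{n-1} D_{n-1} + (c_n - c_{n-1}) (P_{n-1}^2 - P_n^2)],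
    which gives the induction step when [|P_n| < |P_{n-1}|]
    ([turan_increasing]).

    For the failure of amenability, the comparison with the Chebyshev case shows
    [|P_n(0)| <= 1] and [|P_n'(0)| <= 1], so that [chi f = sum f(k) P_k(0) h(k)]
    and [D f = sum f(k) P_k'(0) h(k)] are bounded functionals on [l^1(h)].
    The weight [h(n) h(k) g(k, n; j)] is symmetric in its three indices, hence
    for every bounded sequence [s] the pairing of [f * g] with [s] is an
    absolutely convergent triple series, and summing over the index of [s] first
    leaves the values on the products [P_k P_j] of the linear functional
    [P_n |-> s(n)] ([pairing_convolution]).  The product rule for [(P_k P_j)'(0)] then says
    that [D] is a derivation at the character [chi]; it is nonzero on the
    indicator of [1].  Finally [a |-> D(a) chi] and [a |-> D(a)] are bounded
    derivations into the dual of [l^1(h)] and into the dual of the line on which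
    [l^1(h)] acts through [chi]; the left and right actions agree on both, so
    inner derivations vanish there, and none of the other notions of
    amenability can hold. *)

(** * Monotonicity of the recurrence coefficients *)

Section Coefficients.
Variables (R : realType) (alpha lambda nu : R).
Hypotheses (lambda_ge0 : 0 <= lambda) (nu_gt0 : 0 < nu).
Hypotheses (alpha_gt : - (1 / 2) - nu / 2 < alpha) (alpha_le : alpha <= - (1 / 2)).
Local Notation f := (phi alpha lambda nu).
Local Notation c := (cseq alpha lambda nu).

Lemma phi_gt0 x : 1 <= x -> 0 < f x.
Proof.
move: lambda_ge0 nu_gt0 alpha_gt => ? ? ? x1.
rewrite /phi; apply: divr_gt0; apply: mulr_gt0; lra.
Qed.

Let alpha_sqr : 1 <= 4 * alpha ^+ 2.
Proof.
move: alpha_le => ?; have : 0 <= (- (1 / 2) - alpha) * (1 / 2 - alpha) by apply: mulr_ge0; lra.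
nra.
Qed.

(** The numerator of [4 * phi] is [y ^+ 2 - 4 * alpha ^+ 2] and its denominator
    [(y + 2 * lambda) ^+ 2 - 1], where [y = 2 * x + 2 * nu + 2 * alpha]. *)
Lemma phi_le_quarter x : 1 <= x -> f x <= 1 / 4.
Proof.
move: lambda_ge0 nu_gt0 alpha_gt alpha_sqr => ? ? ? ? x1.
rewrite /phi ler_pdivrMr; last by apply: mulr_gt0; lra.
have l2 : 0 <= lambda * (x + nu + alpha) by apply: mulr_ge0; lra.
nra.
Qed.

(** Over the common denominator the increment [phi z - phi x] is a positive
    multiple of [z - x] times the form [b] below, in which only
    [4 * alpha ^+ 2 - 1] could be negative. *)
Lemma phi_nondecreasing x z : 1 <= x -> x <= z -> f x <= f z.
Proof.
move: lambda_ge0 nu_gt0 alpha_gt alpha_sqr => l0 ? ? a2 x1 xz; have z1 := le_trans x1 xz.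
rewrite /phi ler_pdivrMr; last by apply: mulr_gt0; lra.
rewrite mulrAC ler_pdivlMr; last by apply: mulr_gt0; lra.
pose y t := 2 * t + 2 * nu + 2 * alpha.
have y0 t : 1 <= t -> 0 <= y t by rewrite /y; lra.
pose b := 2 * lambda * (2 * (y x * y z) + 2 * lambda * (y x + y z))
          + (4 * alpha ^+ 2 - 1) * (y x + y z) + 16 * alpha ^+ 2 * lambda.
have b0 : 0 <= b.
  have yx := y0 _ x1; have yz := y0 _ z1.
  have a0 : 0 <= 4 * alpha ^+ 2 - 1 by lra.
  have a20 : 0 <= alpha ^+ 2 := sqr_ge0 _.
  rewrite /b; move: (y x) (y z) (4 * alpha ^+ 2 - 1) yx yz a0 => u v w u0 v0 w0.
  by repeat first [assumption | exact: ler0n | apply: addr_ge0 | apply: mulr_ge0].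
have zx : 0 <= (z - x) / 2 by lra.
rewrite -subr_ge0; move: (mulr_ge0 zx b0); congr (0 <= _).
by rewrite /b /y; field.
Qed.

Lemma cseq_lt_half n : c n < 1 / 2.
Proof.
elim: n => [|n IH] /=; first by lra.
have n1 : 1 <= n.+1%:R :> R by rewrite ler1n.
rewrite ltr_pdivrMr; last by lra.
have := phi_le_quarter n1; lra.
Qed.

Lemma cseq_gt0 n : 0 < c n.+1.
Proof.
rewrite /= divr_gt0 ?phi_gt0 ?ler1n// subr_gt0.
by have := cseq_lt_half n; lra.
Qed.

Lemma cseq_rec n : c n.+1 * (1 - c n) = f n.+1%:R.
Proof. by rewrite /= divfK// gt_eqF//; have := cseq_lt_half n; lra. Qed.

(** If [c n < c n.+1] then
    [phi (n + 2) >= phi (n + 1) = c n.+1 * (1 - c n) > c n.+1 * (1 - c n.+1)],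
    and dividing by [1 - c n.+1] gives the next inequality. *)
Lemma cseq_increasing : {homo c : m n / (m < n)%N >-> m < n}.
Proof.
apply: homo_ltn; first exact: lt_trans.
elim=> [|n IH]; first exact: cseq_gt0.
have a0 m : 0 < 1 - c m by have := cseq_lt_half m; lra.
rewrite -(ltr_pM2r (a0 n.+1)) cseq_rec.
apply: (@lt_le_trans _ _ (f n.+1%:R)).
  by rewrite -cseq_rec ltr_pM2l ?cseq_gt0// ltrD2l ltrN2.
by rewrite phi_nondecreasing ?ler1n// ler_nat.
Qed.

(** The bound is attained for [phi = 1 / 4], the case of the Chebyshev
    polynomials of the second kind [U_n(x) / (n + 1)]. *)
Lemma cseq_le_chebyshev n : c n <= n%:R / (2 * n.+1%:R).
Proof.
elim: n => [|n IH]; first by rewrite mul0r.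
have n0 : 0 <= n%:R :> R := ler0n _ _.
move: IH; rewrite ler_pdivlMr; last by rewrite mulr_gt0// ltr0n.
move=> IH; rewrite ler_pdivlMr; last by rewrite mulr_gt0// ltr0n.
have a0 : 0 < 1 - c n by have := cseq_lt_half n; lra.
rewrite -(ler_pM2r a0) mulrAC cseq_rec.
have n1 : 1 <= n.+1%:R :> R by rewrite ler1n.
have le4 := phi_le_quarter n1; move: (f _) le4 (c n) IH => u le4 v.
have : u * n%:R <= 1 / 4 * n%:R by rewrite ler_wpM2r.
rewrite -!natr1; nra.
Qed.

(** Since [c n < 1 / 2], the claim is that [c n] lies below the smaller root of
    [t * (1 - t) = phi (n + 1)] if there is one, that is
    [c n * (1 - c n) < phi (n + 1)]. *)
Lemma cseq_lt_root n : (0 < n)%N ->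
  c n < 1 / 2 * (1 - Num.sqrt (Num.max 0 (1 - 4 * f n.+1%:R))).
Proof.
move=> n0; have cn := cseq_lt_half n.
have lt_phi : c n * (1 - c n) < f n.+1%:R.
  by rewrite -cseq_rec ltr_pM2r ?cseq_increasing//; lra.
suff : Num.sqrt (Num.max 0 (1 - 4 * f n.+1%:R)) < 1 - 2 * c n by lra.
have d0 : 0 < 1 - 2 * c n by lra.
rewrite -(ltr_pXn2r (n := 2)) ?nnegrE ?sqrtr_ge0//; last exact: ltW.
rewrite sqr_sqrtr ?le_max ?lexx// gt_max exprn_gt0//=; nra.
Qed.

End Coefficients.

(** * Expansion in orthogonal polynomials *)

Section Expansion.
Variables (R : realType) (c : nat -> R).
Hypothesis c_neq1 : forall n, c n != 1.
Local Notation P := (orthopoly c).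
Implicit Types (p q : {poly R}) (g : nat -> R).

Definition expands p g := exists N,
  p = \sum_(k < N) g k *: P k /\ forall k, (N <= k)%N -> g k = 0.

(** The coordinates of [p] in the basis formed by the [P k]. *)
Definition coord p : nat -> R := xget (fun=> 0) [set g | expands p g].

Let expands_widen p g N M :
  p = \sum_(k < N) g k *: P k -> (forall k, (N <= k)%N -> g k = 0) ->
  (N <= M)%N -> p = \sum_(k < M) g k *: P k.
Proof.
move=> pE g0 NM; rewrite pE (big_ord_widen _ (fun k => g k *: P k) NM).
rewrite [RHS](bigID (fun k : 'I_M => (k < N)%N))/= [X in _ + X]big1 ?addr0// => k.
by rewrite -leqNgt => Nk; rewrite g0// scale0r.
Qed.

Let expands_lin a p q g1 g2 : expands p g1 -> expands q g2 ->
  expands (a *: p + q) (fun k => a * g1 k + g2 k).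
Proof.
move=> [N [pE g10]] [M [qE g20]]; exists (maxn N M); split=> [|k]; last first.
  by rewrite geq_max => /andP[Nk Mk]; rewrite g10// g20// mulr0 addr0.
rewrite (expands_widen pE g10 (leq_maxl N M)) (expands_widen qE g20 (leq_maxr N M)).
rewrite scaler_sumr -big_split/=; apply: eq_bigr => k _.
by rewrite scalerDl scalerA.
Qed.

Let expands_uniq p g1 g2 : expands p g1 -> expands p g2 -> g1 = g2.
Proof.
move=> g1P g2P; have [N [E g0]] := expands_lin (-1) g1P g2P.
move: E; rewrite scaleN1r addNr => /esym E.
have gN := @orthopoly_free _ _ N (fun k => -1 * g1 k + g2 k) c_neq1 E.
apply/funext => k; apply/esym/eqP; rewrite -subr_eq0 addrC -mulN1r; apply/eqP.
by have [/gN|/g0] := ltnP k N.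
Qed.

Lemma coordP p : expands p (coord p).
Proof.
apply: (@xgetPex _ _ [set g | expands p g]).
have [g pE g0] := orthopoly_basis c_neq1 (leqnn (size p)).
by exists g, (size p).
Qed.

Lemma coord_uniq p g : expands p g -> coord p = g.
Proof. exact/expands_uniq/coordP. Qed.

Lemma coord_lin a p q k : coord (a *: p + q) k = a * coord p k + coord q k.
Proof. by rewrite (coord_uniq (expands_lin a (coordP p) (coordP q))). Qed.

Lemma coordD p q k : coord (p + q) k = coord p k + coord q k.
Proof. by have := coord_lin 1 p q k; rewrite scale1r mul1r. Qed.

Lemma coord0 k : coord 0 k = 0.
Proof.
by rewrite (@coord_uniq 0 (fun=> 0))//; exists 0%N; rewrite big_ord0.
Qed.

Lemma coordZ a p k : coord (a *: p) k = a * coord p k.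
Proof. by have := coord_lin a p 0 k; rewrite coord0 !addr0. Qed.

Lemma coord_sum n (q : nat -> {poly R}) k :
  coord (\sum_(i < n) q i) k = \sum_(i < n) coord (q i) k.
Proof.
elim: n => [|n IH]; first by rewrite !big_ord0 coord0.
by rewrite !big_ord_recr/= coordD IH.
Qed.

Lemma coord_orthopoly n k : coord (P n) k = (k == n)%:R.
Proof.
rewrite (@coord_uniq _ (fun k => (k == n)%:R))//; exists n.+1; split=> [|i ni].
  rewrite big_ord_recr/= eqxx scale1r big1 ?add0r// => i _.
  by rewrite ltn_eqF// scale0r.
by rewrite gtn_eqF.
Qed.

Lemma lincoefE m n : lincoef c m n = coord (P m * P n).
Proof.
apply/esym/coord_uniq; have [pE g0] := lincoefP m n c_neq1.
by exists (m + n).+1.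
Qed.

Lemma lincoef_eq0 m n k : (m + n < k)%N -> lincoef c m n k = 0.
Proof. by have [_] := lincoefP m n c_neq1; apply. Qed.

Lemma lincoefC m n : lincoef c m n = lincoef c n m.
Proof. by rewrite !lincoefE mulrC. Qed.

Lemma orthopolyM m n :
  P m * P n = \sum_(k < (m + n).+1) lincoef c m n k *: P k.
Proof. by have [] := lincoefP m n c_neq1. Qed.

Hypothesis c0 : c 0 = 0.

(** For [n = 0] the predecessor has the weight [c 0 = 0], so that the
    three-term recurrence needs no exception at the start. *)
Lemma orthopoly_recE n : 'X * P n = (1 - c n) *: P n.+1 + c n *: P n.-1.
Proof.
case: n => [|n]; last exact: orthopoly_rec.
by rewrite c0 subr0 scale0r addr0 scale1r mulr1.
Qed.

Lemma horner_orthopoly_rec n x :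
  x * (P n).[x] = (1 - c n) * (P n.+1).[x] + c n * (P n.-1).[x].
Proof.
by have := congr1 (horner^~ x) (orthopoly_recE n); rewrite hornerM hornerX hornerD !hornerZ.
Qed.

Lemma horner_orthopoly1 n : (P n).[1] = 1.
Proof.
elim/ltn_ind: n => -[|n IH]; first by rewrite hornerC.
have := horner_orthopoly_rec n 1; rewrite (IH n)// (IH n.-1) ?ltnS ?leq_pred//.
have a0 : 1 - c n != 0 by rewrite subr_eq0 eq_sym.
by move=> E; apply: (mulfI a0); lra.
Qed.

(** Evaluation at [1], where all the [P k] take the value [1]. *)
Lemma sum_lincoef m n : \sum_(k < (m + n).+1) lincoef c m n k = 1.
Proof.
have := congr1 (horner^~ 1) (orthopolyM m n).
rewrite hornerM !horner_orthopoly1 mulr1 horner_sum => ->.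
by apply: eq_bigr => k _; rewrite hornerZ horner_orthopoly1 mulr1.
Qed.

Hypothesis c_gt0 : forall n, 0 < c n.+1.
Hypothesis c_lt1 : forall n, c n < 1.

Let coord_XM n q k : coord ('X * P n * q) k =
  (1 - c n) * coord (P n.+1 * q) k + c n * coord (P n.-1 * q) k.
Proof. by rewrite orthopoly_recE mulrDl -!scalerAl coord_lin coordZ. Qed.

Let lincoef_exchange m n k :
  (1 - c m) * lincoef c m.+1 n k + c m * lincoef c m.-1 n k =
  (1 - c n) * lincoef c m n.+1 k + c n * lincoef c m n.-1 k.
Proof.
rewrite ![lincoef c m _]lincoefC !lincoefE -!coord_XM.
by congr (coord _ k); ring.
Qed.

(** The coefficient of [P 0] plays the part of the integral against the
    orthogonality measure: multiplication by ['X] is symmetric for it, which is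
    all that the induction uses. *)
Lemma orthogonal m n : (m < n)%N -> lincoef c m n 0 = 0.
Proof.
elim/ltn_ind: m n => -[|m] IH n mn.
  by rewrite lincoefE mul1r coord_orthopoly eq_sym gtn_eqF.
have a0 : 1 - c m != 0 by rewrite subr_eq0 eq_sym.
apply: (mulfI a0); rewrite mulr0.
have m1n : (m < n.-1)%N by case: n mn.
have mn' : (m.-1 < n)%N by rewrite (leq_ltn_trans (leq_pred _))// ltnW.
have := lincoef_exchange m n 0.
rewrite (IH m (ltnSn _) n.+1) ?(IH m (ltnSn _) n.-1) ?(IH m.-1 _ n) ?ltnS ?leq_pred//.
  by rewrite !mulr0 !addr0.
exact/ltnW/ltnW.
Qed.

Lemma lincoef_diag n : (1 - c n) * lincoef c n.+1 n.+1 0 = c n.+1 * lincoef c n n 0.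
Proof.
have := lincoef_exchange n n.+1 0; rewrite /=.
by rewrite (@orthogonal n.-1) ?ltnS ?leq_pred// (@orthogonal n n.+2)// !mulr0 addr0 add0r.
Qed.

Lemma lincoef_diag_gt0 n : 0 < lincoef c n n 0.
Proof.
elim: n => [|n IH]; first by rewrite lincoefE mul1r (coord_orthopoly 0).
have a0 : 0 < 1 - c n by rewrite subr_gt0.
by rewrite -(pmulr_rgt0 _ a0) lincoef_diag mulr_gt0.
Qed.

Lemma haar_gt0 n : 0 < haar c n.
Proof. by rewrite invr_gt0 lincoef_diag_gt0. Qed.

Let coord0_triple k n j :
  coord (P k * P n * P j) 0 * haar c j = lincoef c k n j.
Proof.
have hj : lincoef c j j 0 != 0 by rewrite gt_eqF// lincoef_diag_gt0.
have tail (i : nat) : i != j -> lincoef c i j 0 = 0.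
  by rewrite neq_ltn => /orP[|] ij; [|rewrite lincoefC]; rewrite orthogonal.
rewrite orthopolyM mulr_suml (coord_sum _ (fun i => lincoef c k n i *: P i * P j)).
under eq_bigr => i _ do rewrite -scalerAl coordZ -lincoefE.
have [jkn|knj] := ltnP j (k + n).+1; last first.
  rewrite lincoef_eq0// big1 ?mul0r// => i _.
  by rewrite tail ?mulr0// ltn_eqF// (leq_trans _ knj).
rewrite (bigD1 (Ordinal jkn))//= big1 ?addr0 ?mulfK// => i ij.
by rewrite tail ?mulr0.
Qed.

(** Both sides are [haar c n * haar c j] times the integral of [P k * P n * P j],
    which is symmetric in its indices. *)
Lemma haar_lincoef k n j : haar c n * lincoef c k n j = haar c j * lincoef c k j n.
Proof.
by rewrite -coord0_triple -[in RHS]coord0_triple [P k * P j * P n]mulrAC; ring.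
Qed.

(** By [haar_lincoef] this is the vanishing of the coefficient of [P n] in
    [P m * P k], whose degree is too small. *)
Lemma lincoef_below (m n k : nat) : (k < `|m - n|%N)%N -> lincoef c m n k = 0.
Proof.
wlog mn : m n / (m <= n)%N.
  by move=> H; have [/H//|/ltnW/H] := leqP m n; rewrite lincoefC distnC.
rewrite (distnEr mn) => kmn.
have hk : haar c n != 0 by rewrite gt_eqF// haar_gt0.
by apply: (mulfI hk); rewrite haar_lincoef mulr0 lincoef_eq0 ?mulr0//; lia.
Qed.

End Expansion.

#[local] Arguments orthopoly : simpl never.

(** * Nonnegative linearization *)

Section Linearization.
Variables (R : realType) (c : nat -> R).
Hypothesis c_lt1 : forall n, c n < 1.
Hypothesis c0 : c 0 = 0.
Hypothesis c_ge0 : forall n, 0 <= c n.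
Local Notation P := (orthopoly c).

Let c_neq1 n : c n != 1. Proof. by rewrite lt_eqF. Qed.

(* [kappa n] makes [M n] monic, and [beta n] is its recurrence coefficient *)
Let kappa n := \prod_(i < n) (1 - c i).
Let M n := kappa n *: P n.
Let beta n := (1 - c n.-1) * c n.

Let kappa_gt0 n : 0 < kappa n.
Proof. by apply: prodr_gt0 => i _; rewrite subr_gt0. Qed.

Let M_rec n : 'X * M n = M n.+1 + beta n *: M n.-1.
Proof.
rewrite /M -scalerAr orthopoly_recE// scalerDr !scalerA /kappa big_ord_recr/=.
congr (_ + _); case: n => [|n]; first by rewrite /beta c0 !mulr0 mul0r !scale0r.
by rewrite big_ord_recr/= /beta/=; congr (_ *: _); ring.
Qed.

Hypothesis beta_nondecreasing :
  {homo (fun n => (1 - c n.-1) * c n) : m n / (m <= n)%N >-> m <= n}.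

Let cone (p : {poly R}) := forall k, 0 <= coord c p k.

Let coneD p q : cone p -> cone q -> cone (p + q).
Proof. by move=> hp hq k; rewrite coordD// addr_ge0. Qed.

Let coneZ a p : 0 <= a -> cone p -> cone (a *: p).
Proof. by move=> a0 hp k; rewrite coordZ// mulr_ge0. Qed.

Let cone_M n : cone (M n).
Proof. by apply: coneZ => [|k]; [exact: ltW | rewrite coord_orthopoly]. Qed.

Let beta_ge0 n : 0 <= beta n.
Proof. by rewrite mulr_ge0// subr_ge0 ltW. Qed.

(** The two claims support each other.  The cross difference satisfies
    [E (m + 1) n = (beta n - beta (m + 1)) M_(m+1) M_(n-1) + beta (m + 1) E m (n - 1)],
    and [M_(m+1) M_n = E m n + M_m M_(n+1)]. *)
Let cone_cross m n : (m <= n)%N ->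
  cone (M m * M n) /\ cone (M m.+1 * M n - M m * M n.+1).
Proof.
elim: m n => [|m IH] n mn.
  have M0 : M 0 = 1 by rewrite /M /kappa big_ord0 scale1r.
  have M1 : M 1 = 'X by rewrite /M /kappa big_ord1 c0 subr0 scale1r.
  rewrite M0 M1 !mul1r M_rec addrC addKr.
  by split; [exact: cone_M | apply: coneZ].
have step k : (m <= k)%N -> cone (M m.+1 * M k).
  move=> mk; have [_ Ek] := IH _ mk; have [MMk _] := IH _ (leqW mk).
  by rewrite -[_ * _](subrK (M m * M k.+1)); apply: coneD.
split; first exact/step/ltnW.
case: n mn => // n mn.
have [_ En] := IH _ mn.
have -> : M m.+2 * M n.+1 - M m.+1 * M n.+2 =
    (beta n.+1 - beta m.+1) *: (M m.+1 * M n) +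
    beta m.+1 *: (M m.+1 * M n - M m * M n.+1).
  have X2 k : M k.+2 = 'X * M k.+1 - beta k.+1 *: M k by rewrite M_rec/= addrK.
  by rewrite !X2 -!mul_polyC rmorphB/=; ring.
by apply: coneD; apply: coneZ => //; [rewrite subr_ge0 beta_nondecreasing | apply: step].
Qed.

(** Askey's criterion: the coefficients of the monic recurrence are
    nondecreasing. *)
Lemma nonneg_linearization_nondecreasing : nonneg_linearization c.
Proof.
move=> m n k _; wlog mn : m n / (m <= n)%N.
  by move=> H; have [/H//|/ltnW/H] := leqP m n; rewrite lincoefC.
have [/(_ k) + _] := cone_cross mn.
rewrite /M -scalerAl -scalerAr scalerA coordZ// -lincoefE//.
by rewrite pmulr_rge0// mulr_gt0.
Qed.

End Linearization.

(** * Turan inequality *)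

Section Turan.
Variables (R : realType) (c : nat -> R).
Hypothesis c_le_half : forall n, c n <= 1 / 2.
Hypothesis c0 : c 0 = 0.
Hypothesis c_inc : forall n, c n < c n.+1.
Local Notation P := (orthopoly c).

Let c_neq1 n : c n != 1.
Proof. by rewrite lt_eqF// (le_lt_trans (c_le_half n))//; lra. Qed.

Let c_ge0 n : 0 <= c n.
Proof. by elim: n => [|n IH]; [rewrite c0 | exact/ltW/(le_lt_trans IH)]. Qed.

(* Otherwise the recurrence, read backwards, would carry the common root down to
   [P 0 = 1]. *)
Let no_common_root x n : ((P n).[x] == 0) && ((P n.+1).[x] == 0) = false.
Proof.
elim: n => [|n IH]; first by rewrite hornerC oner_eq0.
apply/negP => /andP[/eqP p1 /eqP p2]; move/negP: IH; apply.
have := horner_orthopoly_rec c_neq1 c0 n.+1 x.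
rewrite p1 p2 !mulr0 add0r/= => /esym/eqP.
by rewrite mulf_eq0 (gt_eqF (le_lt_trans (c_ge0 n) (c_inc n)))/= => ->; rewrite eqxx.
Qed.

(* The form dominates
   [a * u ^+ 2 + b * v ^+ 2 - u * v = (u - v) * (a * u - b * v)] where
   [u = `|p|] and [v = `|q|]. *)
Let quadratic_gt0 (a b p q x : R) :
  a + b = 1 -> 0 <= b -> b <= a -> `|x| <= 1 -> `|q| <= `|p| ->
  0 <= a * p ^+ 2 + b * q ^+ 2 - x * p * q /\
  (`|x| < 1 -> p != 0 -> 0 < a * p ^+ 2 + b * q ^+ 2 - x * p * q).
Proof.
move=> ab b0 ba x1 qp; rewrite -[p ^+ 2]real_normK ?num_real// -[q ^+ 2]real_normK ?num_real//.
have xpq : x * p * q <= `|x| * (`|p| * `|q|).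
  by rewrite -!normrM mulrA ler_norm.
have q0 := normr_ge0 q.
have diag : 0 <= (`|p| - `|q|) * (a * `|p| - b * `|q|).
  rewrite mulr_ge0 ?subr_ge0// ler_pM//.
have pq0 : 0 <= `|p| * `|q| by rewrite mulr_ge0.
have -> : b = 1 - a by lra.
rewrite (_ : b = 1 - a) in diag; last by lra.
split=> [|x1' p0].
  have : `|x| * (`|p| * `|q|) <= 1 * (`|p| * `|q|) by rewrite ler_wpM2r.
  by lra.
have {}p0 : 0 < `|p| by rewrite normr_gt0.
move: q0; rewrite le_eqVlt => /predU1P[q0|q0].
  rewrite -q0 !mulr0 in xpq *; rewrite expr0n/= mulr0 addr0.
  have : 0 < a * `|p| ^+ 2 by rewrite mulr_gt0 ?exprn_gt0//; lra.
  by lra.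
have : `|x| * (`|p| * `|q|) < 1 * (`|p| * `|q|) by rewrite ltr_pM2r// mulr_gt0.
by lra.
Qed.

Let D x n := (P n).[x] ^+ 2 - (P n.+1).[x] * (P n.-1).[x].

Let determinant_up x n :
  (1 - c n) * D x n =
  (1 - c n) * (P n).[x] ^+ 2 + c n * (P n.-1).[x] ^+ 2
  - x * (P n).[x] * (P n.-1).[x].
Proof. by rewrite /D (horner_orthopoly_rec c_neq1 c0); ring. Qed.

Let determinant_down x n :
  c n * D x n =
  (1 - c n) * (P n.+1).[x] ^+ 2 + c n * (P n).[x] ^+ 2
  - x * (P n.+1).[x] * (P n).[x].
Proof. by rewrite /D mulrAC (horner_orthopoly_rec c_neq1 c0); ring. Qed.

(** Consecutive determinants are tied by
    [(1 - c n.+1) * D n.+1 = c n * D n + (c n.+1 - c n) * (p_n ^+ 2 - p_{n+1} ^+ 2)],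
    which settles the induction step where [|p_{n+1}| < |p_n|].  In the opposite
    case the quadratic form for [D n.+1] is positive by itself. *)
Lemma turan_increasing : turan_inequality c.
Proof.
move=> n n0 /=.
have a0 m : 0 < 1 - c m by have := c_le_half m; lra.
suff turan x m : `|x| <= 1 -> 0 <= D x m /\ (`|x| < 1 -> 0 < D x m.+1).
  split=> x; first by rewrite -ler_norml => /turan-/(_ n)[].
  by rewrite -ltr_norml => x1; case: n n0 => // n _; have [_] := turan x n (ltW x1); apply.
move=> x1.
have step k : 0 <= D x k -> 0 <= D x k.+1 /\ (`|x| < 1 -> 0 < D x k.+1).
  move=> Dk; rewrite -(pmulr_rge0 _ (a0 k.+1)) -(pmulr_rgt0 _ (a0 k.+1)) determinant_up/=.
  have [pk|pk] := leP `|(P k).[x]| `|(P k.+1).[x]|.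
    have ck := c_le_half k.+1.
    have [ge0 gt0] := @quadratic_gt0 (1 - c k.+1) (c k.+1) _ _ x (subrK _ _)
      (c_ge0 _) ltac:(lra) x1 pk.
    split=> // x1'; apply: gt0 => //; apply/eqP => pk1.
    have := no_common_root x k; rewrite pk1 eqxx andbT => /negP; apply.
    by rewrite -normr_le0 (le_trans pk)// pk1 normr0.
  have sq : (P k.+1).[x] ^+ 2 < (P k).[x] ^+ 2.
    by rewrite -[ltLHS]real_normK ?num_real// -[ltRHS]real_normK ?num_real// ltr_pXn2r ?nnegrE.
  have tie : 0 < (c k.+1 - c k) * ((P k).[x] ^+ 2 - (P k.+1).[x] ^+ 2).
    by rewrite mulr_gt0 ?subr_gt0.
  have cD : 0 <= c k * D x k by rewrite mulr_ge0.
  rewrite determinant_down in cD.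
  suff : 0 < (1 - c k.+1) * (P k.+1).[x] ^+ 2 + c k.+1 * (P k).[x] ^+ 2
             - x * (P k.+1).[x] * (P k).[x] by move=> gt0; split=> //; exact: ltW.
  by lra.
suff D0 k : 0 <= D x k by split=> //; have [] := step m (D0 m).
elim: k => [|k /step[]//].
rewrite -(pmulr_rge0 _ (a0 0%N)) determinant_up/= c0 subr0 mul0r addr0 mul1r hornerC.
rewrite expr1n !mulr1 subr_ge0.
by rewrite (le_trans (ler_norm _)).
Qed.

End Turan.

(** * Values and derivatives at zero *)

Section DerivativeAtZero.
Variables (R : realType) (c : nat -> R).
Hypothesis c0 : c 0 = 0.
Hypothesis c_ge0 : forall n, 0 <= c n.
Hypothesis c_le : forall n, c n <= n%:R / (2 * n.+1%:R).
Local Notation P := (orthopoly c).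

Let c_le_half n : c n <= 1 / 2.
Proof.
rewrite (le_trans (c_le n))// ler_pdivrMr ?mulr_gt0// ?ltr0n//.
by rewrite -[n.+1%:R]natr1; lra.
Qed.

Let c_neq1 n : c n != 1.
Proof. by rewrite lt_eqF// (le_lt_trans (c_le_half n))//; lra. Qed.

Lemma deriv_orthopoly_rec n x :
  (P n).[x] + x * (P n)^`().[x] =
  (1 - c n) * (P n.+1)^`().[x] + c n * (P n.-1)^`().[x].
Proof.
have := congr1 (fun p => (p^`()).[x]) (orthopoly_recE c_neq1 c0 n).
by rewrite derivM derivX mul1r !derivD !derivZ !hornerD hornerM hornerX !hornerZ.
Qed.

(** Let [m = 2 k].  The recurrence at [0] gives
    [|P_(m+2)(0)| = c_(m+1) / (1 - c_(m+1)) * |P_m(0)|], which the bound on [c]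
    turns into the decay [1 / (m + 1)], and
    [(1 - c_(m+2)) P_(m+3)'(0) = P_(m+2)(0) - c_(m+2) P_(m+1)'(0)].  The latter
    keeps the derivatives below [1] because
    [1 / (m + 3) <= 1 - 2 * c_(m+2)]. *)
Let bounds_at0 k :
  [/\ `|(P k.*2).[0]| <= k.*2.+1%:R^-1, (P k.*2.+1).[0] = 0,
      (P k.*2)^`().[0] = 0 & `|(P k.*2.+1)^`().[0]| <= 1].
Proof.
elim: k => [|k [p0 p1 d0 d1]].
  by rewrite [P 0]/(1) [P 1]/('X) derivX derivC !hornerE !normr1 invr1.
have a0 n : 0 < 1 - c n by have := c_le_half n; lra.
have an0 n : 1 - c n != 0 by rewrite gt_eqF.
set m := k.*2 in p0 p1 d0 d1 *; rewrite doubleS -/m.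
have m0 : 0 < m.+1%:R :> R by rewrite ltr0n.
have E0 := horner_orthopoly_rec c_neq1 c0 m.+1 0.
have E1 := horner_orthopoly_rec c_neq1 c0 m.+2 0.
have F0 := deriv_orthopoly_rec m.+1 0.
have F1 := deriv_orthopoly_rec m.+2 0.
rewrite !mul0r /= in E0 E1 F0 F1.
have c1 := c_le m.+1; have c2 := c_le m.+2.
rewrite ler_pdivlMr ?mulr_gt0 ?ltr0n// in c1.
rewrite ler_pdivlMr ?mulr_gt0 ?ltr0n// in c2.
have q0 : `|(P m.+2).[0]| <= m.+3%:R^-1.
  have -> : (P m.+2).[0] = - (c m.+1 / (1 - c m.+1) * (P m).[0]).
    apply: (mulfI (an0 m.+1)); rewrite mulrN mulrA mulrCA divff// mulr1.
    by lra.
  rewrite normrN normrM normf_div (ger0_norm (c_ge0 _)) (ger0_norm (ltW (a0 _))).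
  apply: (@le_trans _ _ (m.+1%:R / m.+3%:R * m.+1%:R^-1)).
    apply: ler_pM => //; first by rewrite divr_ge0// ltW.
    rewrite ler_pdivrMr// mulrAC ler_pdivlMr ?ltr0n//.
    by move: c1; rewrite -!natr1; nra.
  by rewrite mulrAC divff ?mul1r// gt_eqF.
split=> //.
- by apply: (mulfI (an0 m.+2)); rewrite mulr0; rewrite p1 in E1; lra.
- by apply: (mulfI (an0 m.+1)); rewrite mulr0; rewrite p1 d0 in F0; lra.
rewrite -(ler_pM2l (a0 m.+2)) mulr1.
have -> : (1 - c m.+2) * `|(P m.+3)^`().[0]| = `|(P m.+2).[0] - c m.+2 * (P m.+1)^`().[0]|.
  rewrite -[X in X * _]ger0_norm ?(ltW (a0 _))// -normrM; congr `|_|.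
  by apply/eqP; rewrite eq_sym subr_eq -F1 addr0.
rewrite (le_trans (ler_normB _ _))//.
have cd : `|c m.+2 * (P m.+1)^`().[0]| <= c m.+2.
  by rewrite normrM (ger0_norm (c_ge0 _)) ler_piMr.
rewrite (le_trans (lerD q0 cd))//.
suff : m.+3%:R^-1 <= 1 - 2 * c m.+2 by move: (_^-1) => u; lra.
rewrite -[leLHS]mul1r ler_pdivrMr ?ltr0n//.
by move: c2; rewrite -!natr1; nra.
Qed.

Lemma orthopoly_at0_le1 n : `|(P n).[0]| <= 1.
Proof.
have [p0 p1 _ _] := bounds_at0 n./2.
rewrite -[n]odd_double_half; case: (odd n); rewrite ?add1n ?add0n.
  by rewrite p1 normr0.
by rewrite (le_trans p0)// invf_le1 ?ltr0n// ler1n.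
Qed.

Lemma deriv_orthopoly_at0_le1 n : `|(P n)^`().[0]| <= 1.
Proof.
have [_ _ d0 d1] := bounds_at0 n./2.
by rewrite -[n]odd_double_half; case: (odd n); rewrite ?add1n ?add0n// d0 normr0.
Qed.

End DerivativeAtZero.

(** * Series of complex numbers *)

Section ComplexSeries.
Variable R : realType.
Local Notation C := R[i]^o.
Local Notation Re := (@complex.Re R).
Local Notation Im := (@complex.Im R).
Implicit Types (x y : R) (z w : R[i]).

Definition cabs z : R := Re `|z|.

Lemma normrE z : `|z| = ((cabs z)%:C)%C.
Proof. by rewrite /cabs normc_def. Qed.

Lemma cabs_ge0 z : 0 <= cabs z.
Proof. by rewrite -lecR -normrE normr_ge0. Qed.

Lemma cabsM z w : cabs (z * w) = cabs z * cabs w.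
Proof. by apply: complexI; rewrite rmorphM/= -!normrE normrM. Qed.

Lemma cabsD z w : cabs (z + w) <= cabs z + cabs w.
Proof. by rewrite -lecR rmorphD/= -!normrE ler_normD. Qed.

Lemma cabsB z w : cabs (z - w) = cabs (w - z).
Proof. by apply: complexI; rewrite -!normrE distrC. Qed.

Lemma cabs_real x : cabs (x%:C)%C = `|x|.
Proof. by rewrite /cabs normc_def/= expr0n/= addr0 sqrtr_sqr. Qed.

Lemma cabs_Re z : `|Re z| <= cabs z.
Proof. by rewrite -lecR -normrE normc_ge_Re. Qed.

Lemma cabs_i : cabs 'i%C = 1.
Proof. by rewrite /cabs normc_def/= expr0n/= add0r expr1n sqrtr1. Qed.

Lemma cabs_Im z : `|Im z| <= cabs z.
Proof.
have -> : cabs z = cabs (z * 'i%C).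
  by rewrite cabsM cabs_i mulr1.
by have := cabs_Re (z * 'i%C); rewrite ReiNIm normrN.
Qed.

Lemma cabs_le z : cabs z <= `|Re z| + `|Im z|.
Proof.
rewrite [X in cabs X]complexE (le_trans (cabsD _ _))// cabsM !cabs_real.
by rewrite cabs_i mul1r.
Qed.

Lemma cvg_complex {T} {F : set_system T} {FF : Filter F} (f : T -> C) (a b : R) :
  (fun t => Re (f t)) @ F --> a -> (fun t => Im (f t)) @ F --> b ->
  f @ F --> ((a +i* b)%C : C).
Proof.
move=> fa fb; apply/cvgrPdist_lt => e; rewrite ltcE/= => /andP[/eqP e0 Ree].
have -> : e = ((Re e)%:C)%C by case: e e0 {Ree} => ? ? /= ->.
have e2 : 0 < Re e / 2 by lra.
move/cvgrPdist_lt/(_ _ e2) : fa => fa; move/cvgrPdist_lt/(_ _ e2) : fb => fb.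
near=> t; rewrite normrE ltcR (le_lt_trans (cabs_le _))//.
have : `|a - Re (f t)| < Re e / 2 by near: t.
have : `|b - Im (f t)| < Re e / 2 by near: t.
by case: (f t) => p q /=; lra.
Unshelve. all: by end_near. Qed.

Lemma complex_complete (F : set_system C) : ProperFilter F -> cauchy F -> cvg F.
Proof.
move=> FF /cauchyP Fc.
have proj (p : C -> R) : (forall z w : C, `|p z - p w| <= cabs (z - w)) ->
    cvg (p @ F).
  move=> p_le; apply/cauchy_cvgP/cauchyP => e e0.
  have e0' : 0 < (e%:C)%C :> R[i] by rewrite ltcR.
  have [z Fz] := Fc _ e0'.
  exists (p z); apply: (@filterS _ F _ (ball z (e%:C)%C)) Fz => w zw.
  move: zw; rewrite -ball_normE/= normrE ltcR => zw.
  by rewrite -ball_normE/= (le_lt_trans (p_le _ _)).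
have /cvg_ex[a Fa] : cvg ((Re : C -> R) @ F).
  by apply: proj => z w; apply: le_trans (cabs_Re _); case: z w => ? ? [].
have /cvg_ex[b Fb] : cvg ((Im : C -> R) @ F).
  by apply: proj => z w; apply: le_trans (cabs_Im _); case: z w => ? ? [].
by apply/cvg_ex; exists ((a +i* b)%C : C); exact: (@cvg_complex _ F _ id).
Qed.

(** The complex line as a Banach space, under a name of its own because the
    canonical completeness of regular modules is the one of real scalars. *)
Definition complex_line : Type := C.
HB.instance Definition _ := NormedModule.copy complex_line C.
HB.instance Definition _ := Uniform_isComplete.Build complex_line complex_complete.

Definition csum (u : nat -> C) : C := limn (series u).
Definition csummable (u : nat -> C) : Prop :=
  (\sum_(0 <= k <oo) (cabs (u k))%:E < +oo)%E.

Lemma nneseries_ge_term (u : nat -> \bar R) n : (forall k, (0 <= u k)%E) ->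
  (u n <= \sum_(0 <= k <oo) u k)%E.
Proof.
move=> u0; apply: le_trans (nneseries_lim_ge n.+1 _) => //.
by rewrite big_nat_recr//= leeDr// sume_ge0.
Qed.

Section RealSeries.
Implicit Types (u : nat -> R) (a : nat -> nat -> R).

Let rsum u : R := limn (series u).

Lemma nnsum_fine u : (forall k, 0 <= u k) ->
  (\sum_(0 <= k <oo) (u k)%:E < +oo)%E ->
  (rsum u)%:E = (\sum_(0 <= k <oo) (u k)%:E)%E.
Proof.
move=> u0 uoo; rewrite -EFin_lim; last exact: nnseries_is_cvg.
by congr (limn _); apply/funext => n; rewrite /series/= sumEFin.
Qed.

Lemma abs_summable_cvg u :
  (\sum_(0 <= k <oo) `|u k|%:E < +oo)%E -> cvgn (series u).
Proof.
by move=> uoo; apply: normed_cvg; apply: (@nnseries_is_cvg _ (fun k => `|u k|)).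
Qed.

Let row_ge0 a (a0 : forall j k, 0 <= a j k) j :
  (0 <= \sum_(0 <= k <oo) (a j k)%:E)%E.
Proof. by apply: nneseries_ge0 => k _ _; rewrite lee_fin. Qed.

Let rsum2_fine a : (forall j k, 0 <= a j k) ->
  (\sum_(0 <= j <oo) \sum_(0 <= k <oo) (a j k)%:E < +oo)%E ->
  (rsum (fun j => rsum (a j)))%:E = (\sum_(0 <= j <oo) \sum_(0 <= k <oo) (a j k)%:E)%E
  /\ cvgn (series (fun j => rsum (a j))).
Proof.
move=> a0 aoo.
have E j : (rsum (a j))%:E = (\sum_(0 <= k <oo) (a j k)%:E)%E.
  by apply: nnsum_fine => //; exact: le_lt_trans (nneseries_ge_term j (row_ge0 a0)) aoo.
have r0 j : 0 <= rsum (a j).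
  by rewrite -lee_fin E; apply: nneseries_ge0 => k _ _; rewrite lee_fin.
under eq_eseriesr do rewrite -E.
have roo : (\sum_(0 <= j <oo) (rsum (a j))%:E < +oo)%E.
  by under eq_eseriesr do rewrite E.
by split; [exact: nnsum_fine | exact: nnseries_is_cvg].
Qed.

Let rsum_swap_nn a : (forall j k, 0 <= a j k) ->
  (\sum_(0 <= j <oo) \sum_(0 <= k <oo) (a j k)%:E < +oo)%E ->
  rsum (fun j => rsum (a j)) = rsum (fun k => rsum (a^~ k)).
Proof.
move=> a0 aoo; apply: EFin_inj; rewrite (rsum2_fine a0 aoo).1.
have swap : (\sum_(0 <= j <oo) \sum_(0 <= k <oo) (a j k)%:E =
             \sum_(0 <= k <oo) \sum_(0 <= j <oo) (a j k)%:E)%E.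
  by apply: nneseries_interchange => j k; rewrite lee_fin.
rewrite swap in aoo *.
by rewrite (@rsum2_fine (fun k j => a j k) _ aoo).1.
Qed.

(** Splitting into positive and negative parts reduces the interchange to
    Tonelli's theorem. *)
Lemma rsum_swap a :
  (\sum_(0 <= j <oo) \sum_(0 <= k <oo) `|a j k|%:E < +oo)%E ->
  rsum (fun j => rsum (a j)) = rsum (fun k => rsum (a^~ k)) /\
  cvgn (series (fun j => rsum (a j))).
Proof.
move=> aoo.
pose p j k := Num.max (a j k) 0; pose q j k := Num.max (- a j k) 0.
have p0 j k : 0 <= p j k by rewrite le_max lexx orbT.
have q0 j k : 0 <= q j k by rewrite le_max lexx orbT.
have pa j k : p j k <= `|a j k| by rewrite ge_max ler_norm normr_ge0.
have qa j k : q j k <= `|a j k| by rewrite ge_max -normrN ler_norm normr_ge0.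
have apq j k : a j k = p j k - q j k.
  by rewrite /p /q; case: (leP (a j k) 0) => ?; case: (leP (- a j k) 0) => ?; lra.
have dom (b : nat -> nat -> R) : (forall j k, 0 <= b j k) ->
    (forall j k, b j k <= `|a j k|) ->
    (\sum_(0 <= j <oo) \sum_(0 <= k <oo) (b j k)%:E < +oo)%E.
  move=> b0 ba; apply: le_lt_trans aoo; apply: lee_nneseries => j _.
    by move=> _; apply: nneseries_ge0 => k _ _; rewrite lee_fin.
  by apply: lee_nneseries => k; rewrite lee_fin.
have poo := dom _ p0 pa; have qoo := dom _ q0 qa.
have cvg_row (b : nat -> nat -> R) j : (forall j k, 0 <= b j k) ->
    (\sum_(0 <= j <oo) \sum_(0 <= k <oo) (b j k)%:E < +oo)%E -> cvgn (series (b j)).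
  move=> b0 boo; apply: nnseries_is_cvg => //.
  exact: le_lt_trans (nneseries_ge_term j (row_ge0 b0)) boo.
have swapped (b : nat -> nat -> R) : (forall j k, 0 <= b j k) ->
    (\sum_(0 <= j <oo) \sum_(0 <= k <oo) (b j k)%:E < +oo)%E ->
    (\sum_(0 <= k <oo) \sum_(0 <= j <oo) (b j k)%:E < +oo)%E.
  by move=> b0; rewrite nneseries_interchange// => j k; rewrite lee_fin.
have poo' := swapped _ p0 poo; have qoo' := swapped _ q0 qoo.
have rowE : (fun j => rsum (a j)) = (fun j => rsum (p j)) - (fun j => rsum (q j)).
  apply/funext => j; rewrite -[RHS]lim_seriesB; try exact: cvg_row.
  by congr (limn (series _)); apply/funext => k; rewrite apq.
have colE : (fun k => rsum (a^~ k)) = (fun k => rsum (p^~ k)) - (fun k => rsum (q^~ k)).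
  apply/funext => k; rewrite -[RHS]lim_seriesB.
  - by congr (limn (series _)); apply/funext => j; rewrite apq.
  - exact: (cvg_row (fun k j => p j k)).
  - exact: (cvg_row (fun k j => q j k)).
have cp := (rsum2_fine p0 poo).2; have cq := (rsum2_fine q0 qoo).2.
have cp' := (@rsum2_fine (fun k j => p j k) (fun _ _ => p0 _ _) poo').2.
have cq' := (@rsum2_fine (fun k j => q j k) (fun _ _ => q0 _ _) qoo').2.
split; last by rewrite rowE; apply: is_cvg_seriesB.
rewrite rowE colE {1}/rsum lim_seriesB// [RHS]lim_seriesB//.
by rewrite -!/(rsum _) (rsum_swap_nn p0 poo) (rsum_swap_nn q0 qoo).
Qed.

End RealSeries.

End ComplexSeries.

Section ComplexSums.
Variable R : realType.
Local Notation C := R[i]^o.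
Local Notation Re := (@complex.Re R).
Local Notation Im := (@complex.Im R).
Implicit Types (x y : R) (z w : R[i]) (u v : nat -> C).

Lemma csum_parts u : csummable u -> cvgn (series u) /\
  csum u = (limn (series (fun k => Re (u k))) +i* limn (series (fun k => Im (u k))))%C.
Proof.
move=> uoo.
have part (p : C -> R) : (forall z w : C, p (z + w) = p z + p w) -> p 0 = 0 ->
    (forall z, `|p z| <= cabs z) ->
    (fun n => p (series u n)) @ \oo --> limn (series (fun k => p (u k))).
  move=> pD p0 p_le.
  have -> : (fun n => p (series u n)) = series (fun k => p (u k)).
    by apply/funext => n; rewrite /series/= (big_morph p pD p0).
  apply: abs_summable_cvg; apply: le_lt_trans uoo.
  by apply: lee_nneseries => k; rewrite lee_fin.
have ReD z w : Re (z + w) = Re z + Re w by case: z w => ? ? [].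
have ImD z w : Im (z + w) = Im z + Im w by case: z w => ? ? [].
have cRe := part Re ReD erefl (@cabs_Re R).
have cIm := part Im ImD erefl (@cabs_Im R).
set a := limn _ in cRe; set b := limn _ in cIm.
have ucvg : series u @ \oo --> ((a +i* b)%C : C).
  exact: (cvg_complex cRe cIm).
split; first by apply/cvg_ex; eexists; exact: ucvg.
exact: (cvg_lim (@norm_hausdorff _ C) ucvg).
Qed.

Lemma csummable_le u (b : nat -> R) : (forall k, cabs (u k) <= b k) ->
  (\sum_(0 <= k <oo) (b k)%:E < +oo)%E -> csummable u.
Proof.
move=> ub; apply: le_lt_trans; apply: lee_nneseries => k.
  by rewrite lee_fin cabs_ge0.
by rewrite lee_fin.
Qed.

Lemma csummableZ z u : csummable u -> csummable (fun k => z * u k).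
Proof.
move=> us; apply: (@csummable_le _ (fun k => cabs z * cabs (u k))).
  by move=> k; rewrite cabsM.
under eq_eseriesr do rewrite EFinM.
rewrite nneseriesZl => [|k _]; last by rewrite lee_fin cabs_ge0.
by rewrite lte_mul_pinfty ?lee_fin ?cabs_ge0.
Qed.

Lemma csumD u v : csummable u -> csummable v ->
  csum (fun k => u k + v k) = csum u + csum v.
Proof.
move=> /csum_parts[cu _] /csum_parts[cv _].
rewrite /csum (_ : series _ = series u \+ series v); last first.
  by apply/funext => n; rewrite /series/= big_split.
by apply: (cvg_lim (@norm_hausdorff _ C)); apply: cvgD; [exact: cu | exact: cv].
Qed.

Lemma csumZ z u : csummable u -> csum (fun k => z * u k) = z * csum u.
Proof.
move=> /csum_parts[cu _].
rewrite /csum (_ : series _ = z *: series u); last first.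
  by apply/funext => n; rewrite /series/= -mulr_sumr.
by apply: (cvg_lim (@norm_hausdorff _ C)); apply: cvgZl_tmp; exact: cu.
Qed.

Lemma csum_finite u N : (forall k, (N <= k)%N -> u k = 0) ->
  csum u = \sum_(k < N) u k.
Proof.
move=> u0; apply: (lim_near_cst (@norm_hausdorff _ C)); exists N => // n /= Nn.
rewrite /series/= (big_cat_nat (leq0n N) Nn)/= big_mkord.
suff -> : \sum_(N <= k < n) u k = 0 by rewrite addr0.
by rewrite big_nat_cond big1// => k /andP[/andP[/u0]].
Qed.

Lemma csum_le u : csummable u ->
  ((cabs (csum u))%:E <= \sum_(0 <= k <oo) (cabs (u k))%:E)%E.
Proof.
move=> us; have [/cvg_ex[l ul] _] := csum_parts us.
rewrite /csum (cvg_lim (@norm_hausdorff _ C) ul).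
have cvg_abs : (fun n => cabs (series u n)) @ \oo --> cabs l.
  apply/cvgrPdist_lt => e e0.
  have e0' : 0 < (e%:C)%C :> R[i] by rewrite ltcR.
  move/cvgrPdist_lt/(_ _ e0') : ul; apply: filterS => n.
  rewrite normrE ltcR; apply: le_lt_trans.
  rewrite ler_norml lerBlDr lerNl opprB lerBlDr; apply/andP; split.
    by rewrite cabsB (le_trans _ (cabsD _ _))// subrK.
  by rewrite (le_trans _ (cabsD _ _))// subrK.
have cvg_absE : (fun n => (cabs (series u n))%:E) @ \oo --> (cabs l)%:E.
  by apply: cvg_EFin; [exact: nearW | exact: cvg_abs].
rewrite -(cvg_lim (@ereal_hausdorff _) cvg_absE); apply: lime_le.
  by apply/cvg_ex; eexists; exact: cvg_absE.
apply: nearW => n.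
apply: le_trans (nneseries_lim_ge n _) => [|k _ _]; last by rewrite lee_fin cabs_ge0.
rewrite sumEFin lee_fin /series/=; elim: n => [|n IH].
  by rewrite !big_nil /cabs normr0.
by rewrite !big_nat_recr//= (le_trans (cabsD _ _))// lerD2r.
Qed.

(** Fubini's theorem for series, through the real and imaginary parts. *)
Lemma csum_swap (a : nat -> nat -> C) :
  (\sum_(0 <= j <oo) \sum_(0 <= k <oo) (cabs (a j k))%:E < +oo)%E ->
  csum (fun j => csum (a j)) = csum (fun k => csum (a^~ k)).
Proof.
move=> aoo.
have abs_ge0 j k : (0 <= (cabs (a j k))%:E)%E by rewrite lee_fin cabs_ge0.
have aoo' : (\sum_(0 <= k <oo) \sum_(0 <= j <oo) (cabs (a j k))%:E < +oo)%E.
  by rewrite nneseries_interchange.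
have row (b : nat -> nat -> C) :
    (\sum_(0 <= j <oo) \sum_(0 <= k <oo) (cabs (b j k))%:E < +oo)%E ->
    (forall j, csummable (b j)) /\ csummable (fun j => csum (b j)).
  move=> boo; have b_ge0 j k : (0 <= (cabs (b j k))%:E)%E by rewrite lee_fin cabs_ge0.
  have bs j : csummable (b j).
    apply: le_lt_trans (nneseries_ge_term j _) boo => i.
    exact: nneseries_ge0.
  split=> //; apply: le_lt_trans boo.
  by apply: lee_nneseries => j; rewrite ?lee_fin ?cabs_ge0// => _; exact: csum_le.
have [as1 cs1] := row a aoo; have [as2 cs2] := row (fun k j => a j k) aoo'.
have part (p : C -> R) : (forall z, `|p z| <= cabs z) ->
    (forall u, csummable u -> p (csum u) = limn (series (fun k => p (u k)))) ->
    p (csum (fun j => csum (a j))) = p (csum (fun k => csum (a^~ k))).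
  move=> p_le p_csum; rewrite !p_csum//.
  have -> : (fun j => p (csum (a j))) = (fun j => limn (series (fun k => p (a j k)))).
    by apply/funext => j; rewrite p_csum.
  have -> : (fun k => p (csum (a^~ k))) = (fun k => limn (series (fun j => p (a j k)))).
    by apply/funext => k; rewrite p_csum//; exact: as2.
  apply: (rsum_swap (a := fun j k => p (a j k)) _).1.
  apply: le_lt_trans aoo; apply: lee_nneseries => j _.
    by move=> _; exact: nneseries_ge0.
  by apply: lee_nneseries => k; rewrite lee_fin.
apply/eqP; rewrite eq_complex; apply/andP; split; apply/eqP; apply: part.
- exact: cabs_Re.
- by move=> u /csum_parts[_ ->].
- exact: cabs_Im.
- by move=> u /csum_parts[_ ->].
Qed.

Lemma csum_product u v : csummable u -> csummable v ->
  csum (fun k => csum (fun j => u k * v j)) = csum u * csum v.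
Proof.
move=> us vs; rewrite mulrC -(csumZ _ us); congr csum; apply/funext => k.
by rewrite (csumZ _ vs) mulrC.
Qed.

Lemma csum_bilinear (u v u' v' : nat -> C) :
  csummable u -> csummable v -> csummable u' -> csummable v' ->
  csum (fun k => csum (fun j => u k * v j + u' k * v' j)) =
  csum u * csum v + csum u' * csum v'.
Proof.
move=> us vs us' vs'; rewrite [csum u * _]mulrC [csum u' * _]mulrC.
rewrite -(csumZ _ us) -(csumZ _ us') -csumD; try exact: csummableZ.
congr csum; apply/funext => k.
rewrite csumD; try exact: csummableZ.
by rewrite (csumZ _ vs) (csumZ _ vs') mulrC [csum v' * _]mulrC.
Qed.

(** Two interchanges move the outermost of three summations to the inside. *)
Lemma csum_rotate (a : nat -> nat -> nat -> C) :
  (\sum_(0 <= n <oo) \sum_(0 <= k <oo) \sum_(0 <= j <oo) (cabs (a n k j))%:E < +oo)%E ->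
  [/\ forall n k, csummable (a n k),
      forall n, csummable (fun k => csum (a n k)) &
      csum (fun n => csum (fun k => csum (a n k))) =
      csum (fun k => csum (fun j => csum (fun n => a n k j)))].
Proof.
move=> aoo.
have e0 n k j : (0 <= (cabs (a n k j))%:E)%E by rewrite lee_fin cabs_ge0.
have e1 n k : (0 <= \sum_(0 <= j <oo) (cabs (a n k j))%:E)%E by exact: nneseries_ge0.
have fin1 n : (\sum_(0 <= k <oo) \sum_(0 <= j <oo) (cabs (a n k j))%:E < +oo)%E.
  apply: le_lt_trans (nneseries_ge_term n _) aoo => m.
  exact: nneseries_ge0.
have fin2 n k : csummable (a n k).
  apply: le_lt_trans (fin1 n).
  exact: (@nneseries_ge_term _ (fun k => \sum_(0 <= j <oo) (cabs (a n k j))%:E)%E k (e1 n)).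
have le2 n k : ((cabs (csum (a n k)))%:E <= \sum_(0 <= j <oo) (cabs (a n k j))%:E)%E.
  exact: csum_le.
have sum1 n : csummable (fun k => csum (a n k)).
  apply: le_lt_trans (fin1 n); apply: lee_nneseries => // k.
  by rewrite lee_fin cabs_ge0.
split=> //; rewrite csum_swap.
  congr (csum _); apply/funext => k; rewrite csum_swap//.
  have swapped := aoo; rewrite nneseries_interchange// in swapped.
  apply: le_lt_trans (nneseries_ge_term k _) swapped => m.
  by apply: nneseries_ge0.
apply: le_lt_trans aoo; apply: lee_nneseries => n.
  by move=> _ _; apply: nneseries_ge0 => k _ _; rewrite lee_fin cabs_ge0.
by move=> _; apply: lee_nneseries => // k; rewrite lee_fin cabs_ge0.
Qed.

End ComplexSums.

(** * The convolution algebra *)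

Section ConvolutionAlgebra.
Variables (R : realType) (c : nat -> R).
Hypothesis c0 : c 0 = 0.
Hypothesis c_gt0 : forall n, 0 < c n.+1.
Hypothesis c_lt1 : forall n, c n < 1.
Hypothesis c_nonneg : nonneg_linearization c.
Local Notation C := R[i]^o.
Local Notation P := (orthopoly c).
Local Notation L := (lincoef c).
Local Notation h := (haar c).
Local Notation "x %:C" := (real_complex R x : C).
Implicit Types (f g : nat -> C) (s : nat -> R).

Let c_neq1 n : c n != 1. Proof. by rewrite lt_eqF. Qed.

Let h_gt0 n : 0 < h n. Proof. exact: haar_gt0. Qed.

Let L_ge0 m n k : 0 <= L m n k.
Proof. by have [/c_nonneg//|/lincoef_eq0->] := leqP k (m + n). Qed.

Definition pairing s f : C := csum (fun k => f k * (s k)%:C * (h k)%:C).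

Definition bounded_by (M : R) s := forall k, `|s k| <= M.

Lemma l1norme_ge0 f : (0 <= l1norme c f)%E.
Proof.
by apply: nneseries_ge0 => k _ _; rewrite lee_fin mulr_ge0 ?cabs_ge0// ltW.
Qed.

Lemma l1normeK f : l1 c f -> ((fine (l1norme c f))%:E = l1norme c f)%E.
Proof. by move=> lf; rewrite fineK// ge0_fin_numE// l1norme_ge0. Qed.

Let weighted_le M s f : bounded_by M s ->
  forall k, cabs (f k * (s k)%:C * (h k)%:C) <= M * (cabs (f k) * h k).
Proof.
move=> sM k; rewrite !cabsM !cabs_real (gtr0_norm (h_gt0 k)) mulrAC mulrC.
by rewrite ler_wpM2r// mulr_ge0 ?cabs_ge0// ltW.
Qed.

Let weighted_sum M f : 
  (\sum_(0 <= k <oo) (M * (cabs (f k) * h k))%:E)%E = (M%:E * l1norme c f)%E.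
Proof.
under eq_eseriesr do rewrite EFinM.
by rewrite nneseriesZl// => k _; rewrite lee_fin mulr_ge0 ?cabs_ge0// ltW.
Qed.

Lemma pairing_summable M s f : bounded_by M s -> l1 c f ->
  csummable (fun k => f k * (s k)%:C * (h k)%:C).
Proof.
move=> sM lf; apply: (csummable_le (weighted_le f sM)).
by rewrite weighted_sum -l1normeK// -EFinM ltry.
Qed.

Lemma pairing_le M s f : bounded_by M s -> l1 c f ->
  `|pairing s f| <= M%:C * l1norm c f.
Proof.
move=> sM lf; rewrite normrE -rmorphM lecR -lee_fin EFinM l1normeK//.
rewrite -weighted_sum (le_trans (csum_le (pairing_summable sM lf)))//.
apply: lee_nneseries => k; first by rewrite lee_fin cabs_ge0.
by rewrite lee_fin weighted_le.
Qed.

Lemma pairing_linear M s : bounded_by M s -> linear_on (l1 c) (pairing s).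
Proof.
move=> sM z u v lu lv.
have su := pairing_summable sM lu; have sv := pairing_summable sM lv.
rewrite /pairing -(csumZ _ su) -(csumD (csummableZ z su) sv).
congr csum; apply/funext => k.
have -> : (z *: u + v) k = z * u k + v k by [].
by rewrite !mulrDl !mulrA.
Qed.

(* [h n * h k * h j] times the integral of [P n * P k * P j], hence symmetric in
   the three indices *)
Let w n k j := h n * h k * L k n j.

Let w_swap n k j : w n k j = w k n j.
Proof. by rewrite /w lincoefC// mulrAC [RHS]mulrAC; ring. Qed.

Let w_rot n k j : w n k j = w j k n.
Proof. by rewrite /w mulrAC haar_lincoef//; ring. Qed.

Let w_ge0 n k j : 0 <= w n k j.
Proof. by rewrite /w !mulr_ge0// ltW. Qed.

Let sum_w k j : (\sum_(0 <= n <oo) (w n k j)%:E)%E = (h k * h j)%:E.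
Proof.
rewrite (nneseries_split _ (k + j).+1); last by move=> n _; rewrite lee_fin.
rewrite [X in (_ + X)%E]eseries0 ?adde0; last first.
  by move=> n; rewrite add0n => kjn _; rewrite w_rot /w lincoef_eq0 ?mulr0.
rewrite sumEFin add0n big_mkord.
under eq_bigr => n _ do rewrite w_rot.
by rewrite -mulr_sumr sum_lincoef// mulr1 mulrC.
Qed.

(* the general term of the triple series for the pairing of [f * g] with the
   constant sequence [1] *)
Let T f g n k j : C := (w n k j)%:C * (g k * f j).

Let T_abs f g n k j : cabs (T f g n k j) = w n k j * (cabs (g k) * cabs (f j)).
Proof. by rewrite !cabsM cabs_real ger0_norm. Qed.

(** Tonelli: summation over [n] first leaves
    [M * (cabs (f j) * h j) * (cabs (g k) * h k)], by [sum_w]. *)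
Let T_dominated (a : nat -> nat -> nat -> C) M f g : l1 c f -> l1 c g -> 0 <= M ->
  (forall n k j, cabs (a n k j) <= M * cabs (T f g n k j)) ->
  (\sum_(0 <= n <oo) \sum_(0 <= k <oo) \sum_(0 <= j <oo) (cabs (a n k j))%:E < +oo)%E.
Proof.
move=> lf lg M0 a_le.
pose e n k j := ((M * (cabs (g k) * cabs (f j)) * w n k j)%:E)%E.
have x0 k j : 0 <= M * (cabs (g k) * cabs (f j)) by rewrite !mulr_ge0 ?cabs_ge0.
have e0 n k j : (0 <= e n k j)%E by rewrite lee_fin mulr_ge0.
have le_e n k j : ((cabs (a n k j))%:E <= e n k j)%E.
  rewrite lee_fin (le_trans (a_le _ _ _))// T_abs.
  by rewrite le_eqVlt; apply/orP; left; apply/eqP; ring.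
apply: (@le_lt_trans _ _ (\sum_(0 <= n <oo) \sum_(0 <= k <oo) \sum_(0 <= j <oo) e n k j)%E).
  apply: lee_nneseries => [n _ _|n _].
    by do 2![apply: nneseries_ge0 => ? _ _]; rewrite lee_fin cabs_ge0.
  apply: lee_nneseries => [k _ _|k _].
    by apply: nneseries_ge0 => ? _ _; rewrite lee_fin cabs_ge0.
  by apply: lee_nneseries => [j _ _|j _//]; rewrite lee_fin cabs_ge0.
rewrite nneseries_interchange; last by move=> n k; exact: nneseries_ge0.
have -> : (\sum_(0 <= k <oo) \sum_(0 <= n <oo) \sum_(0 <= j <oo) e n k j =
  \sum_(0 <= k <oo) (M * (cabs (g k) * h k))%:E * l1norme c f)%E.
  apply: eq_eseriesr => k _; rewrite nneseries_interchange//.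
  rewrite -nneseriesZl; last by move=> j _; rewrite lee_fin mulr_ge0 ?cabs_ge0// ltW.
  apply: eq_eseriesr => j _; rewrite /e.
  under eq_eseriesr do rewrite EFinM.
  rewrite nneseriesZl; last by move=> n _; rewrite lee_fin.
  by rewrite sum_w -!EFinM; congr (_%:E); rewrite /cabs; ring.
rewrite -(l1normeK lf).
under eq_eseriesr do rewrite muleC.
rewrite nneseriesZl; last first.
  by move=> k _; rewrite lee_fin !mulr_ge0 ?cabs_ge0// ltW.
by rewrite weighted_sum -(l1normeK lg) -!EFinM ltry.
Qed.


Let T_summable f g : l1 c f -> l1 c g ->
  (\sum_(0 <= n <oo) \sum_(0 <= k <oo) \sum_(0 <= j <oo)
     (cabs (T f g n k j))%:E < +oo)%E.
Proof. by move=> lf lg; apply: (T_dominated lf lg ler01) => n k j; rewrite mul1r. Qed.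

Let T_finite f g n k : csum (T f g n k) = (h n * h k)%:C * g k * translation c n f k.
Proof.
rewrite (@csum_finite _ _ (k + n).+1) => [|j jkn]; last first.
  by rewrite /T /w lincoef_eq0// mulr0 rmorph0 mul0r.
rewrite /translation mulr_sumr -(big_mkord xpredT (T f g n k)).
have kn : (`|k - n|%N <= (k + n).+1)%N by lia.
rewrite (big_cat_nat (leq0n _) kn)/=.
rewrite big_nat_cond big1 ?add0r => [|j /andP[/andP[_ jkn] _]]; last first.
  by rewrite /T /w lincoef_below// mulr0 rmorph0 mul0r.
apply: eq_bigr => j _; rewrite /T /w !rmorphM/=; ring.
Qed.

Lemma convolution_haar f g n : l1 c f -> l1 c g ->
  convolution c f g n * (h n)%:C = csum (fun k => csum (T f g n k)).
Proof.
move=> lf lg.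
have [_ sT _] := csum_rotate (T_summable lf lg).
have hn : (h n)%:C != 0 by rewrite eq_complex/= eqxx andbT gt_eqF.
have -> : convolution c f g n = csum (fun k => (h n)%:C^-1 * csum (T f g n k)).
  congr csum; apply/funext => k; rewrite T_finite rmorphM/=.
  by rewrite -!mulrA mulKf//; ring.
by rewrite csumZ; [rewrite mulrC mulrA divff// mul1r | exact: sT].
Qed.

(** Interchange the two summations of [convolution_haar] and use the symmetry of
    the weight. *)
Lemma convolutionC f g : l1 c f -> l1 c g -> convolution c f g = convolution c g f.
Proof.
move=> lf lg; apply/funext => n.
have hn : (h n)%:C != 0 by rewrite eq_complex/= eqxx andbT gt_eqF.
apply: (mulIf hn); rewrite !convolution_haar// csum_swap; last first.
  apply: le_lt_trans (nneseries_ge_term n _) (T_summable lf lg) => m.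
  by apply: nneseries_ge0 => k _ _; apply: nneseries_ge0 => j _ _; rewrite lee_fin cabs_ge0.
congr csum; apply/funext => k; congr csum; apply/funext => j.
by rewrite /T w_rot w_swap w_rot mulrC [in RHS]mulrC; ring.
Qed.

(** Summing over [n] first turns [s] into the values of the linear functional
    [P n |-> s n] on the products [P k * P j]. *)
Lemma pairing_convolution M s f g : bounded_by M s -> l1 c f -> l1 c g ->
  pairing s (convolution c f g) = csum (fun k => csum (fun j =>
    g k * (h k)%:C * (f j * (h j)%:C) *
    (\sum_(n < (k + j).+1) L k j n * s n)%:C)).
Proof.
move=> sM lf lg.
have aoo := T_dominated (a := fun n k j => (s n)%:C * T f g n k j) lf lg
  (le_trans (normr_ge0 _) (sM 0%N))
  (fun n k j => ltac:(by rewrite cabsM cabs_real; apply: ler_wpM2r; [exact: cabs_ge0 | exact: sM])).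
have [_ _ rot] := csum_rotate aoo.
have [sT3 sT4 _] := csum_rotate (T_summable lf lg).
transitivity (csum (fun n => csum (fun k => csum (fun j => (s n)%:C * T f g n k j)))).
  congr csum; apply/funext => n.
  have -> : convolution c f g n * (s n)%:C * (h n)%:C =
    (s n)%:C * (convolution c f g n * (h n)%:C) by ring.
  rewrite (convolution_haar n lf lg) -(csumZ _ (sT4 n)).
  by congr csum; apply/funext => k; rewrite csumZ//; exact: sT3.
rewrite rot; congr csum; apply/funext => k; congr csum; apply/funext => j.
rewrite (@csum_finite _ _ (k + j).+1) => [|n kjn]; last first.
  have w0 : w n k j = 0 by rewrite w_rot /w (lincoef_eq0 c_neq1 kjn) mulr0.
  by rewrite /T w0 rmorph0 mul0r mulr0.
rewrite rmorph_sum/= mulr_sumr; apply: eq_bigr => n _.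
by rewrite /T w_rot /w !rmorphM/=; ring.
Qed.

End ConvolutionAlgebra.

(** * The point derivation and its consequences *)

Section PointDerivation.
Variables (R : realType) (c : nat -> R).
Hypothesis c0 : c 0 = 0.
Hypothesis c_gt0 : forall n, 0 < c n.+1.
Hypothesis c_lt1 : forall n, c n < 1.
Hypothesis c_nonneg : nonneg_linearization c.
Local Notation C := R[i]^o.
Local Notation P := (orthopoly c).
Local Notation L := (lincoef c).
Local Notation h := (haar c).
Local Notation "x %:C" := (real_complex R x : C).
Implicit Types (f g : nat -> C).

Let c_neq1 n : c n != 1. Proof. by rewrite lt_eqF. Qed.

Variables (x M : R).
Let p k := (P k).[x].
Let d k := (P k)^`().[x].
Hypothesis p_bounded : bounded_by M p.
Hypothesis d_bounded : bounded_by M d.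

Let chi := pairing c p.
Let D := pairing c d.

Let sum_p k j : \sum_(n < (k + j).+1) L k j n * p n = p k * p j.
Proof.
have := congr1 (horner^~ x) (orthopolyM c_neq1 k j).
rewrite hornerM horner_sum => /esym; under eq_bigr do rewrite hornerZ.
by [].
Qed.

Let sum_d k j : \sum_(n < (k + j).+1) L k j n * d n = d k * p j + p k * d j.
Proof.
have := congr1 (fun q => q^`().[x]) (orthopolyM c_neq1 k j).
rewrite derivM hornerD !hornerM raddf_sum horner_sum /= => /esym.
by under eq_bigr do rewrite derivZ hornerZ.
Qed.

(** [chi] is the Fourier transform at [x]; here the functional of
    [pairing_convolution] is evaluation at [x], which is multiplicative. *)
Lemma fourier_convolution f g : l1 c f -> l1 c g ->
  chi (convolution c f g) = chi f * chi g.
Proof.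
move=> lf lg.
have sf := pairing_summable c0 c_gt0 c_lt1 p_bounded lf.
have sg := pairing_summable c0 c_gt0 c_lt1 p_bounded lg.
rewrite [RHS]mulrC -(csum_product sg sf).
rewrite /chi (pairing_convolution c0 c_gt0 c_lt1 c_nonneg p_bounded lf lg).
congr csum; apply/funext => k; congr csum; apply/funext => j.
by rewrite sum_p rmorphM/=; ring.
Qed.

(** The functional of [pairing_convolution] is now [q |-> q'(x)], and the claim
    is the product rule for [P k * P j]. *)
Lemma derivation_convolution f g : l1 c f -> l1 c g ->
  D (convolution c f g) = chi f * D g + chi g * D f.
Proof.
move=> lf lg.
have pf := pairing_summable c0 c_gt0 c_lt1 p_bounded lf.
have pg := pairing_summable c0 c_gt0 c_lt1 p_bounded lg.
have df := pairing_summable c0 c_gt0 c_lt1 d_bounded lf.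
have dg := pairing_summable c0 c_gt0 c_lt1 d_bounded lg.
rewrite /D (pairing_convolution c0 c_gt0 c_lt1 c_nonneg d_bounded lf lg).
rewrite [chi f * _]mulrC -(csum_bilinear dg pf pg df).
congr csum; apply/funext => k; congr csum; apply/funext => j.
by rewrite sum_d rmorphD !rmorphM/=; ring.
Qed.

Definition delta (i k : nat) : C := (k == i)%:R.

Let l1_delta i : l1 c (delta i).
Proof.
rewrite /l1/= /l1norme (nneseries_split _ i.+1); last first.
  by move=> k _; rewrite lee_fin mulr_ge0// ?cabs_ge0// ltW// haar_gt0.
rewrite [X in (_ + X)%E]eseries0 ?adde0 ?sumEFin ?ltry// => k.
by rewrite add0n => ik _; rewrite /delta gtn_eqF// normr0 mul0r.
Qed.

Let pairing_delta s i : pairing c s (delta i) = (s i * h i)%:C.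
Proof.
rewrite /pairing (@csum_finite _ _ i.+1) => [|k ik]; last first.
  by rewrite /delta gtn_eqF// !mul0r.
rewrite big_ord_recr/= big1 ?add0r => [|k _]; last first.
  by rewrite /delta ltn_eqF// !mul0r.
by rewrite /delta eqxx mul1r rmorphM.
Qed.

Let chi_delta0 : chi (delta 0) != 0.
Proof.
rewrite /chi pairing_delta /p [P 0]/(1) hornerC mul1r eq_complex/= eqxx andbT.
by rewrite gt_eqF// haar_gt0.
Qed.

Let D_delta1 : D (delta 1) != 0.
Proof.
rewrite /D pairing_delta /d [P 1]/('X) derivX hornerC mul1r eq_complex/= eqxx andbT.
by rewrite gt_eqF// haar_gt0.
Qed.

Let chi_le f : l1 c f -> `|chi f| <= M%:C * l1norm c f.
Proof. exact: pairing_le. Qed.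

Let D_le f : l1 c f -> `|D f| <= M%:C * l1norm c f.
Proof. exact: pairing_le. Qed.

Let chi_lin : linear_on (l1 c) chi.
Proof. exact: (pairing_linear c0 c_gt0 c_lt1 p_bounded). Qed.

Let D_lin : linear_on (l1 c) D.
Proof. exact: (pairing_linear c0 c_gt0 c_lt1 d_bounded). Qed.

Lemma not_point_amenable : ~ point_amenable c.
Proof.
apply; exists x.
  by exists M => _ [n _ <-]; exact: p_bounded.
exists D; split.
- by split; [exact: D_lin | exists M%:C; exact: D_le].
- by exists (delta 1); [exact: l1_delta | exact: D_delta1].
- by move=> f g lf lg; rewrite derivation_convolution.
Qed.

(** [a |-> D a * chi] is a derivation into the dual; an inner one would vanish by
    commutativity. *)
Lemma not_weakly_amenable : ~ weakly_amenable (l1_algebra c).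
Proof.
move=> /(_ (fun a y => D a * chi y))[].
  split=> /=.
  - move=> a la; split.
      by move=> z u v lu lv; rewrite chi_lin//; ring.
    exists (`|D a| * M%:C) => u lu.
    by rewrite normrM -mulrA ler_wpM2l// chi_le.
  - by move=> y ly z u v lu lv; rewrite D_lin//; ring.
  - exists (M%:C * M%:C) => a y la ly; rewrite normrM.
    rewrite (_ : _ * _ * _ * _ = (M%:C * l1norm c a) * (M%:C * l1norm c y)).
      by apply: ler_pM; [exact: normr_ge0 | exact: normr_ge0 | exact: D_le | exact: chi_le].
    by ring.
  - move=> a b y la lb ly.
    by rewrite derivation_convolution// !fourier_convolution//; ring.
move=> f _ /(_ (delta 1) (delta 0) (l1_delta 1) (l1_delta 0))/=.
rewrite (convolutionC c0 c_gt0 c_lt1 c_nonneg (l1_delta 0) (l1_delta 1)) subrr.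
by move/eqP; rewrite mulf_eq0 (negbTE D_delta1) (negbTE chi_delta0).
Qed.

Let chi_structure : structure_space (A := l1_algebra c) chi.
Proof.
split; first exact: chi_lin.
- by move=> f g lf lg; exact: fourier_convolution.
- by exists (delta 0); [exact: l1_delta | exact: chi_delta0].
Qed.

Let bimodule_chi : is_banach_bimodule (A := l1_algebra c)
  (X := complex_line R)
  (fun a (y : C) => chi a * y) (fun (y : C) a => chi a * y).
Proof.
split.
- by move=> a la k y z; split; rewrite mulrDr -!scalerAr.
- by move=> a b la lb k y; split; rewrite chi_lin// mulrDl -mulrA.
- move=> a b la lb y; split; rewrite ?(fourier_convolution la lb); ring.
- exists M%:C => a la y.
  by rewrite normrM; split; rewrite ler_wpM2r// chi_le.
Qed.

(** [D] itself is a derivation into the dual of the line on which both actions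
    are given by [chi], where inner derivations vanish. *)
Let not_char_amenable : ~ char_amenable (A := l1_algebra c) chi.
Proof.
move=> /(_ (complex_line R) _ _ bimodule_chi (fun _ _ _ => erefl) (fun a (y : C) => D a * y))[].
  split=> /=.
  - move=> a la; split; first by move=> z u v _ _; rewrite mulrDr -scalerAr.
    by exists `|D a| => u _; rewrite normrM.
  - by move=> y _ z u v lu lv; rewrite D_lin//; ring.
  - by exists M%:C => a y la _; rewrite normrM ler_wpM2r// D_le.
  - by move=> a b y la lb _; rewrite derivation_convolution//; ring.
move=> f _ /(_ (delta 1) 1 (l1_delta 1) I)/=.
by rewrite subrr mulr1 => /eqP; rewrite (negbTE D_delta1).
Qed.

Lemma not_right_character_amenable : ~ right_character_amenable (l1_algebra c).
Proof. by move=> [/(_ chi chi_structure) + _]; exact: not_char_amenable. Qed.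

Lemma not_amenable : ~ amenable (l1_algebra c).
Proof. by move=> am; apply: not_char_amenable => X l r bim _; exact: am. Qed.

End PointDerivation.

(** * The theorem *)

Theorem theorem6p1 (R : realType) (alpha lambda nu : R)
    (lambda_ge0 : 0 <= lambda) (nu_gt0 : 0 < nu)
    (alpha_gt : - (1 / 2) - nu / 2 < alpha) (alpha_le : alpha <= - (1 / 2)) :
  let c := cseq alpha lambda nu in
  (forall n : nat, (0 < n)%N -> 0 < c n < 1) /\
  [/\ forall m n : nat, (0 < m)%N -> (m < n)%N -> c m < c n,
      nonneg_linearization c,
      turan_inequality c &
      forall n : nat, (0 < n)%N ->
        c n < 1 / 2 *
              (1 - Num.sqrt (Num.max 0 (1 - 4 * phi alpha lambda nu n.+1%:R)))] /\
  [/\ ~ point_amenable c,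
      ~ weakly_amenable (l1_algebra c),
      ~ right_character_amenable (l1_algebra c) &
      ~ amenable (l1_algebra c)].
Proof.
move=> c.
have c_lt_half n : c n < 1 / 2 by exact: cseq_lt_half.
have c_lt1 n : c n < 1 by have := c_lt_half n; lra.
have c_gt0 n : 0 < c n.+1 by exact: cseq_gt0.
have c_inc : {homo c : m n / (m < n)%N >-> m < n} by exact: cseq_increasing.
have c0 : c 0 = 0 by [].
have c_ge0 n : 0 <= c n by case: n => [|n]; [rewrite c0 | exact/ltW/c_gt0].
have c_le_half n : c n <= 1 / 2 by exact/ltW/c_lt_half.
have c_le n : c n <= n%:R / (2 * n.+1%:R) by exact: cseq_le_chebyshev.
have c_nonneg : nonneg_linearization c.
  apply: nonneg_linearization_nondecreasing => // m n mn.
  case: n mn => [|n]; first by rewrite leqn0 => /eqP->.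
  case: m => [|m] mn; first by rewrite c0 mulr0 mulr_ge0// subr_ge0 ltW.
  rewrite mulrC cseq_rec// [leRHS]mulrC cseq_rec//.
  by apply: phi_nondecreasing => //; rewrite ?ler1n// ler_nat.
have p_bounded : bounded_by 1 (fun k => (orthopoly c k).[0]).
  by move=> k; exact: orthopoly_at0_le1.
have d_bounded : bounded_by 1 (fun k => (orthopoly c k)^`().[0]).
  by move=> k; exact: deriv_orthopoly_at0_le1.
split; first by case=> // n _; rewrite c_gt0 c_lt1.
split; split.
- by move=> m n _; exact: c_inc.
- exact: c_nonneg.
- by apply: turan_increasing => // n; exact: c_inc.
- by move=> n; exact: cseq_lt_root.
- exact: (not_point_amenable c0 c_gt0 c_lt1 c_nonneg p_bounded d_bounded).
- exact: (not_weakly_amenable c0 c_gt0 c_lt1 c_nonneg p_bounded d_bounded).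
- exact: (not_right_character_amenable c0 c_gt0 c_lt1 c_nonneg p_bounded d_bounded).
- exact: (not_amenable c0 c_gt0 c_lt1 c_nonneg p_bounded d_bounded).
Qed.
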